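(* Let $n\ge 1$ and let $f\in\mathbb{R}[t,x,y]$ be homogeneous of degree $n$, hyperbolic with respect to $(1,0,0)$, with $f(1,0,0)=1$. (a) If $f$ is invariant under the action of the cyclic group $C_n$, then there exists a cyclic weighted shift matrix $A\in\mathbb{C}^{n\times n}$ such that $f=f_A$. (b) If $f$ is invariant under the action of the dihedral group $D_n$, then there exists a cyclic weighted shift matrix $B\in\mathbb{R}^{n\times n}$ such that $f=f_B$.
   Context: Hyperbolicity: a homogeneous $f\in\mathbb{R}[t,x,y]$ is hyperbolic with respect to $e\in\mathbb{R}^3$ if $f(e)\neq 0$ and for every $z\in\mathbb{R}^3$ all (complex) roots of the univariate polynomial $f(e+\lambda z)\in\mathbb{R}[\lambda]$ are real. Group actions: $C_n=\langle\Phi\rangle$ and $D_n=\langle\Phi,\Gamma\rangle$, where $\Phi(t,x,y)=\big(t,\ \cos(\tfrac{2\pi}{n})x-\sin(\tfrac{2\pi}{n})y,\ \sin(\tfrac{2\pi}{n})x+\cos(\tfrac{2\pi}{n})y\big)$ and $\Gamma(t,x,y)=(t,x,-y)$. A polynomial $f$ is invariant under a group $G$ if $f(\Xi(t,x,y))=f(t,x,y)$ for every generator $\Xi$ of $G$. Cyclic weighted shift matrix: a matrix $A=S(a_1,\dots,a_n)\in\mathbb{C}^{n\times n}$ with entries $A_{i,i+1}=a_i$ for $1\le i\le n-1$, $A_{n,1}=a_n$, and all other entries $0$. For $A\in\mathbb{C}^{n\times n}$, $f_A(t,x,y):=\det\big(tI_n+x\,\Re(A)+y\,\Im(A)\big)$,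 where $\Re(A)=\frac{A+A^{*}}{2}$, $\Im(A)=\frac{A-A^{*}}{2i}$, and $A^*$ is the conjugate transpose. *)

(* Defs.v *)
From HB Require Import structures.
From mathcomp Require Import all_boot all_order all_algebra.
From mathcomp Require Import reals trigo.
From mathcomp Require Import complex mpoly.

Set Implicit Arguments.
Unset Strict Implicit.
Unset Printing Implicit Defensive.

Import Order.TTheory GRing.Theory Num.Theory.
Local Open Scope ring_scope.

(* The variables t, x, y of R[t,x,y] are 'X_0, 'X_1, 'X_2 in {mpoly R[3]}. *)

Definition vec3 (T : Type) (a b c : T) : 'I_3 -> T := tnth [tuple a; b; c].

Section Hyperbolicity.
Variable R : realType.
Implicit Types (f : {mpoly R[3]}) (e z : 'I_3 -> R).

(* The univariate polynomial f(e + lambda z), with lambda = 'X. *)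
Definition line_poly f e z : {poly R} :=
  mmap polyC (fun i => (e i)%:P + z i *: 'X) f.

Definition hyperbolic f e : Prop :=
  f.@[e] != 0 /\
  forall (z : 'I_3 -> R) (l : R[i]),
    root (map_poly (real_complex R) (line_poly f e z)) l -> l \is Num.real.

End Hyperbolicity.

Section Invariance.
Variable R : realType.
Implicit Types (n : nat) (f : {mpoly R[3]}).

Definition Phi n : 3.-tuple {mpoly R[3]} :=
  let theta : R := 2 * pi / n%:R in
  [tuple 'X_0; cos theta *: 'X_1 - sin theta *: 'X_2;
               sin theta *: 'X_1 + cos theta *: 'X_2].

Definition Gamma : 3.-tuple {mpoly R[3]} := [tuple 'X_0; 'X_1; - 'X_2].

Definition cyclic_invariant n f : Prop := comp_mpoly (Phi n) f = f.

Definition dihedral_invariant n f : Prop :=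
  comp_mpoly (Phi n) f = f /\ comp_mpoly Gamma f = f.

End Invariance.

(* S(a_1, ..., a_n).  ordS i is i + 1 modulo n, so the last row has its entry
   in the first column; for n = 1 the matrix is (a_1). *)
Definition cyclic_shift (T : pzRingType) (n : nat) (a : 'I_n -> T) : 'M[T]_n :=
  \matrix_(i, j) (if j == ordS i then a i else 0).

Section DeterminantalPolynomial.
Variables (R : realType) (n : nat).
Implicit Type A : 'M[R[i]]_n.

Definition mxRe A : 'M[R[i]]_n := 2^-1 *: (A + A ^t*%sesqui).
Definition mxIm A : 'M[R[i]]_n := (2 * 'i%C)^-1 *: (A - A ^t*%sesqui).

Definition det_poly A : {mpoly R[i][3]} :=
  \det (('X_0)%:M + 'X_1 *: map_mx (@mpolyC 3 _) (mxRe A)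
                + 'X_2 *: map_mx (@mpolyC 3 _) (mxIm A)).

End DeterminantalPolynomial.

(* Main.v *)
Require Import Defs.
From HB Require Import structures.
From mathcomp Require Import all_boot all_order all_algebra.
From mathcomp Require Import reals trigo.
From mathcomp Require Import ring lra zify.
From mathcomp Require Import complex mpoly.

(** In the coordinates u = x + iy and v = x - iy the rotation multiplies u by
    omega = exp(2 pi i / n) and v by its inverse, so the only monomials of
    degree n that can occur in an invariant f are t^(n - 2k) (uv)^k, u^n and v^n
    ([rotation_support]).  Thus f is described by a real monic polynomial
    P of degree n, with the parity of n, and one complex number alpha: f is the
    homogenization of P (with uv of degree 2) plus alpha u^n + conj(alpha) v^n.
    On the unit circle uv = 1 and the last two terms take every value in
    [-2 |alpha|, 2 |alpha|]; hyperbolicity therefore makes P + c real-rooted for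
    c = 0 and c = 2 |alpha|, - 2 |alpha| ([cyclic_invariant_data]).

    On the other side, f_A is the determinant of t I + (v A + u A^* )/2.  For a
    cyclic weighted shift this is a periodic tridiagonal matrix with t on the
    diagonal.  With p_i = |a_i|^2 / 4, and Q, K, L the continuants, in
    a variable s, of the weights on the paths 1..n-1, 2..n-1 and 1..n-2 (vertices 0..n-1), its
    determinant is the homogenization of s Q - p_0 K - p_(n-1) L plus
    (-1)^(n-1) (prod a_i (v/2)^n + its conjugate) ([det_cyclic_tridiag]).  So one
    needs p_i >= 0 with P = s Q - p_0 K - p_(n-1) L and product |alpha|^2; the
    arguments of the a_i then only have to fix the argument of alpha, and signs
    suffice when alpha is real, which the reflection y -> - y forces.

    Finding the p_i is an inverse spectral problem ([cyclic_weights_exist]).  If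
    alpha = 0, the matrix may be cut into blocks of size at most 2, one for each
    pair of opposite roots of P.  If b = |alpha| > 0, Laguerre's inequality
    F'^2 - F F'' > 0, valid where the real-rooted F does not vanish, applied to
    F = P + 2b and F = P - 2b shows that at every critical point m of P one has |P(m)| >= 2b and
    P(m) P''(m) < 0 ([critical_values]).  Take Q = P'/n.  In a solution, the
    numbers p_0 K(m) and p_(n-1) L(m) have sum - P(m) and product b^2, so they
    are the roots of z^2 + P(m) z + b^2, which are real.  Conversely choose for
    each m one of these roots and interpolate them by a polynomial X.  The sign
    condition says that X / Q has positive residues, i.e. that the roots of X
    and Q interlace, and the Euclidean algorithm applied to Q and X produces the
    remaining weights, all positive ([jacobi_chain]); parity makes every
    quotient a multiple of the variable, which is why the diagonal vanishes.  The
    last weight is defined by the product condition, and the identity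
    P = s Q - p_0 K - p_(n-1) L holds because both sides agree at the critical
    points, by the Wronskian identity for continuants ([chain_wronskian]). *)

Set Implicit Arguments.
Unset Strict Implicit.
Unset Printing Implicit Defensive.

Import Order.TTheory GRing.Theory Num.Theory.
Local Open Scope ring_scope.

(** * Polynomials with real roots and interlacing *)

Section RootProducts.
Variable F : fieldType.
Implicit Types (s : seq F) (p X : {poly F}).

Definition roots_poly s : {poly F} := \prod_(x <- s) ('X - x%:P).

Lemma roots_poly_cons x s : roots_poly (x :: s) = ('X - x%:P) * roots_poly s.
Proof. by rewrite /roots_poly big_cons. Qed.

Lemma size_roots_poly s : size (roots_poly s) = (size s).+1.
Proof. exact: size_prod_XsubC. Qed.

Lemma roots_poly_eq0 s x : ((roots_poly s).[x] == 0) = (x \in s).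
Proof. exact: (root_prod_XsubC s x). Qed.

Lemma deriv_roots_poly_cons x s :
  (roots_poly (x :: s))^`() = roots_poly s + ('X - x%:P) * (roots_poly s)^`().
Proof. by rewrite roots_poly_cons derivM derivXsubC mul1r. Qed.

Lemma poly_eq_on_roots s (p q : {poly F}) : uniq s -> (size p <= size s)%N ->
    (size q <= size s)%N -> {in s, forall x, p.[x] = q.[x]} -> p = q.
Proof.
move=> us sp sq e; apply/eqP; rewrite -subr_eq0; apply/eqP.
apply: (@roots_geq_poly_eq0 _ _ s) => //.
  by apply/allP => x xs; rewrite /root !hornerE e // subrr.
by apply: leq_trans (size_polyD _ _) _; rewrite size_polyN geq_max sp sq.
Qed.

Lemma interpolation s (g : F -> F) : uniq s ->
  exists2 X : {poly F}, (size X <= size s)%N & {in s, forall x, X.[x] = g x}.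
Proof.
elim: s => [|x s IH] /=; first by exists 0; rewrite ?size_poly0.
move=> /andP[xs /IH[X sX hX]].
have Qx : (roots_poly s).[x] != 0 by rewrite roots_poly_eq0.
exists (X + ((g x - X.[x]) / (roots_poly s).[x]) *: roots_poly s).
  apply: leq_trans (size_polyD _ _) _; rewrite geq_max (leqW sX) /=.
  by apply: leq_trans (size_scale_leq _ _) _; rewrite size_roots_poly.
move=> y; rewrite inE !hornerE => /orP[/eqP->|ys].
  by rewrite divfK // addrC subrK.
have /eqP-> : (roots_poly s).[y] == 0 by rewrite roots_poly_eq0.
by rewrite mulr0 addr0 hX.
Qed.

(** One step of the partial fraction expansion of X over the polynomial with
    roots x :: s; w is the residue at x. *)
Lemma split_residue x s X : x \notin s -> (size X <= (size s).+1)%N ->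
  exists w (Y : {poly F}), X = w *: roots_poly s + ('X - x%:P) * Y /\ (size Y <= size s)%N.
Proof.
move=> xs sX; have Qx : (roots_poly s).[x] != 0 by rewrite roots_poly_eq0.
pose w := X.[x] / (roots_poly s).[x].
have /factor_theorem[Y hY] : root (X - w *: roots_poly s) x.
  by rewrite /root !hornerE /w divfK // subrr.
exists w, Y; split; first by rewrite mulrC -hY addrC subrK.
have [->|Y0] := eqVneq Y 0; first by rewrite size_poly0.
have sYX : size (Y * ('X - x%:P)) = (size Y).+1.
  by rewrite size_Mmonic ?monicXsubC // size_XsubC addn2.
rewrite -ltnS -sYX -hY.
apply: leq_trans (size_polyD _ _) _; rewrite geq_max sX /= size_polyN.
by apply: leq_trans (size_scale_leq _ _) _; rewrite size_roots_poly.
Qed.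

(** A repeated entry of s would be a common root of the product and of its
    derivative. *)
Lemma simple_roots_uniq s : {in s, forall x, (roots_poly s)^`().[x] != 0} -> uniq s.
Proof.
elim: s => //= x s IH h.
have := h x (mem_head _ _); rewrite deriv_roots_poly_cons !hornerE subrr mul0r addr0.
rewrite roots_poly_eq0 => -> /=; apply: IH => y ys.
have := h y; rewrite inE ys orbT => /(_ isT).
have /eqP Qy : (roots_poly s).[y] == 0 by rewrite roots_poly_eq0.
by rewrite deriv_roots_poly_cons !hornerE Qy add0r mulf_eq0 => /norP[].
Qed.
End RootProducts.

Section RealRooted.
Variable R : realFieldType.

(** The left-hand side is the square of the polynomial times the sum of the
    1/(t - x)^2.  For F = (X - x) G it equals
    G^2 plus (t - x)^2 times the same expression for G, which makes the induction
    immediate and also covers repeated roots. *)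
Lemma laguerre (s : seq R) t :
  0 <= (roots_poly s)^`().[t] ^+ 2 - (roots_poly s).[t] * (roots_poly s)^`()^`().[t] /\
  (s != [::] -> (roots_poly s).[t] != 0 ->
    0 < (roots_poly s)^`().[t] ^+ 2 - (roots_poly s).[t] * (roots_poly s)^`()^`().[t]).
Proof.
elim: s => [|x s [IH _]].
  by rewrite /roots_poly big_nil -polyC1 !derivC !hornerE; split=> //; rewrite subr0 sqr_ge0.
have -> : (roots_poly (x :: s))^`().[t] ^+ 2 -
    (roots_poly (x :: s)).[t] * (roots_poly (x :: s))^`()^`().[t] =
    (roots_poly s).[t] ^+ 2 + (t - x) ^+ 2 *
    ((roots_poly s)^`().[t] ^+ 2 - (roots_poly s).[t] * (roots_poly s)^`()^`().[t]).
  rewrite deriv_roots_poly_cons roots_poly_cons derivD derivM derivXsubC !hornerE.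
  by rewrite /=; ring.
have h2 := mulr_ge0 (sqr_ge0 (t - x)) IH.
split=> [|_]; first by rewrite addr_ge0 ?sqr_ge0.
rewrite roots_poly_cons !hornerE mulf_eq0 negb_or => /andP[_ Q0].
by rewrite ltr_wpDr // exprn_even_gt0.
Qed.
End RealRooted.

(** Contribution of one more pole to the imaginary part of X(z) conj(Q(z)),
    written with z - conj(z) so that no real and imaginary parts are needed. *)
Lemma conj_residue_step (C : numClosedFieldType) (z x w q y r : C) :
  x^* = x -> w^* = w -> y * q^* - y^* * q = - (z - z^*) * r ->
  (w * q + (z - x) * y) * ((z - x) * q)^* -
    (w * q + (z - x) * y)^* * ((z - x) * q) =
  - (z - z^*) * (w * (q * q^*) + (z - x) * (z - x)^* * r).
Proof.
move=> xr wr e; have zx : (z - x)^* = z^* - x by rewrite rmorphB /= xr.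
rewrite [(w * q + _)^*]rmorphD !rmorphM /= zx wr.
transitivity (- (z - z^*) * (w * (q * q^*)) + (z - x) * (z^* - x) *
  (y * q^* - y^* * q)); first by ring.
by rewrite e; ring.
Qed.

Section Interlacing.
Variable R : rcfType.
Local Notation C := R[i].
Local Notation toC := (real_complex R).
Implicit Types (s : seq R) (X : {poly R}).

(** All residues of X / Q, Q the monic polynomial with root list s, are positive:
    the algebraic form of interlacing. *)
Definition residue_pos s X :=
  (size X <= size s)%N /\ {in s, forall m, 0 < X.[m] * (roots_poly s)^`().[m]}.

Lemma residue_pos_cons x s X : uniq (x :: s) -> residue_pos (x :: s) X ->
  exists w (Y : {poly R}), [/\ X = w *: roots_poly s + ('X - x%:P) * Y, 0 < w & residue_pos s Y].
Proof.
rewrite /= => /andP[xs us] [sX hX].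
have [w [Y [eX sY]]] := split_residue xs sX.
exists w, Y; split => //.
  have := hX x (mem_head _ _); rewrite eX deriv_roots_poly_cons !hornerE subrr.
  rewrite !mul0r !addr0 -mulrA -expr2 pmulr_lgt0 // exprn_even_gt0 //=.
  by rewrite roots_poly_eq0.
split=> // m ms.
have := hX m; rewrite inE ms orbT => /(_ isT).
have /eqP Qm : (roots_poly s).[m] == 0 by rewrite roots_poly_eq0.
have xm : m - x != 0 by rewrite subr_eq0; apply: contraNneq xs => <-.
rewrite eX deriv_roots_poly_cons !hornerE Qm mulr0 !add0r.
have -> a b : (m - x) * a * ((m - x) * b) = (m - x) ^+ 2 * (a * b) by ring.
by rewrite pmulr_rgt0 // exprn_even_gt0.
Qed.

(** X / Q is a sum of w / (t - m) with w > 0, so it decreases between its poles;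
    multiplied by Q^2 this holds at every t. *)
Lemma residue_pos_wronskian s X t : uniq s -> residue_pos s X -> s != [::] ->
  0 < (roots_poly s)^`().[t] * X.[t] - (roots_poly s).[t] * X^`().[t].
Proof.
elim: s X => // x s IH X us rX _.
have [w [Y [-> w0 rY]]] := residue_pos_cons us rX.
move: us; rewrite cons_uniq => /andP[xs us].
have -> : (roots_poly (x :: s))^`().[t] * (w *: roots_poly s + ('X - x%:P) * Y).[t] -
   (roots_poly (x :: s)).[t] * ((w *: roots_poly s + ('X - x%:P) * Y)^`()).[t] =
   w * (roots_poly s).[t] ^+ 2 + (t - x) ^+ 2 *
   ((roots_poly s)^`().[t] * Y.[t] - (roots_poly s).[t] * Y^`().[t]).
  rewrite deriv_roots_poly_cons roots_poly_cons derivD derivZ derivM derivXsubC !hornerE.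
  by rewrite /=; ring.
have [s0|sn] := eqVneq s [::].
  move: rY; rewrite s0 => -[+ _]; rewrite size_poly_leq0 => /eqP->.
  by rewrite /roots_poly big_nil derivC !hornerE /= !mulr1 -polyC0 derivC horner0 oppr0 mulr0 addr0.
have h := IH _ us rY sn.
have [Q0|Q0] := eqVneq (roots_poly s).[t] 0.
  rewrite {1}Q0 expr0n mulr0 add0r mulr_gt0 // exprn_even_gt0 //= subr_eq0.
  by apply: contraNneq xs => <-; rewrite -roots_poly_eq0 Q0.
rewrite ltr_pwDl //; first by rewrite mulr_gt0 // exprn_even_gt0.
by rewrite mulr_ge0 ?sqr_ge0 // ltW.
Qed.

(** The leading coefficient is the sum of the residues. *)
Lemma residue_pos_lead s X : uniq s -> residue_pos s X -> s != [::] ->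
  0 < X`_(size s).-1.
Proof.
elim: s X => // x s IH X us rX _.
have [w [Y [-> w0 rY]]] := residue_pos_cons us rX.
move: us; rewrite cons_uniq => /andP[xs us] /=; rewrite coefD coefZ.
have := monic_prod_XsubC s xpredT id; rewrite monicE -/(roots_poly s) lead_coefE.
rewrite size_roots_poly /= => /eqP ->; rewrite mulr1.
rewrite ltr_pwDl //.
case: s IH us rY {xs rX} => [|y s] IH us rY; rewrite mulrBl coefB coefXM coefCM.
  have [sY _] := rY; move: sY; rewrite size_poly_leq0 => /eqP->.
  by rewrite !coefC /= mulr0 subrr.
have [sY _] := rY; rewrite [Y`_(size (y :: s))]nth_default // mulr0 subr0 /=.
by apply: ltW; apply: IH.
Qed.

(** The imaginary part of a sum of w / (z - m), w > 0, is opposite in sign to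
    that of z; multiplying by |Q(z)|^2 avoids dividing by Q(z). *)
Lemma sum_residues_nonreal s (X : {poly R}) (z : C) : uniq s -> residue_pos s X ->
  let Qz := (map_poly toC (roots_poly s)).[z] in
  let Xz := (map_poly toC X).[z] in
  exists r : C, [/\ Xz * Qz^* - Xz^* * Qz = - (z - z^*) * r, 0 <= r &
     (s != [::] -> z \isn't Num.real -> 0 < r)].
Proof.
elim: s X => [|x s IH] X us rX /=.
  exists 0; split => //.
  have [sX _] := rX; move: sX; rewrite size_poly_leq0 => /eqP->.
  by rewrite rmorph0 horner0 rmorph0 !mul0r subrr mulr0.
have [w [Y [-> w0 rY]]] := residue_pos_cons us rX.
move: us; rewrite cons_uniq => /andP[xs us]; have [r [er r0 _]] := IH _ us rY.
set Qz := (map_poly toC (roots_poly s)).[z] in er.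
set Yz := (map_poly toC Y).[z] in er.
have xr : (toC x)^* = toC x by apply/CrealP/complex_realP; eexists.
have wr : (toC w)^* = toC w by apply/CrealP/complex_realP; eexists.
have -> : (map_poly toC (roots_poly (x :: s))).[z] = (z - toC x) * Qz.
  by rewrite roots_poly_cons rmorphM /= map_polyXsubC !hornerE.
have -> : (map_poly toC (w *: roots_poly s + ('X - x%:P) * Y)).[z] =
    toC w * Qz + (z - toC x) * Yz.
  by rewrite rmorphD /= map_polyZ !rmorphM /= map_polyXsubC !hornerE.
exists (toC w * (Qz * Qz^*) + (z - toC x) * (z - toC x)^* * r); split.
- exact: conj_residue_step.
- apply: addr_ge0; apply: mulr_ge0; rewrite ?mul_conjC_ge0 //.
  by have := ltW w0; rewrite -ler0c.
move=> _ zr; rewrite ltr_pwDl //; last by apply: mulr_ge0; rewrite ?mul_conjC_ge0.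
apply: mulr_gt0; first by have := w0; rewrite -ltcR.
rewrite mul_conjC_gt0 /Qz /roots_poly rmorph_prod horner_prod.
rewrite prodf_seq_neq0; apply/allP => y ys /=.
rewrite map_polyXsubC !hornerE subr_eq0.
by apply: contraNneq zr => ->; apply/complex_realP; eexists.
Qed.

(** Gauss-Lucas type argument: off the real axis the imaginary part of X / Q
    does not vanish. *)
Lemma residue_pos_real_roots s X (z : C) : uniq s -> residue_pos s X ->
  s != [::] -> root (map_poly toC X) z -> z \is Num.real.
Proof.
move=> us rX sn /eqP Xz; have [r [er _ r0]] := sum_residues_nonreal z us rX.
apply: contraT => zr; have {}r0 := r0 sn zr.
move: er; rewrite Xz rmorph0 !mul0r subrr => /esym/eqP.
rewrite mulf_eq0 (gt_eqF r0) orbF oppr_eq0 subr_eq0 => /eqP zz.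
by case/negP: zr; apply/CrealP.
Qed.

Lemma real_rooted_split (p : {poly R}) :
  (forall z, root (map_poly toC p) z -> z \is Num.real) -> p != 0 ->
  exists2 s, p = lead_coef p *: roots_poly s & size s = (size p).-1.
Proof.
move=> hr p0; have [r er] := closed_field_poly_normal (map_poly toC p).
rewrite lead_coef_map in er.
have hs : map toC (map (@complex.Re R) r) = r.
  rewrite -map_comp map_id_in // => z zr /=.
  apply/RRe_real/hr; rewrite er rootZ ?root_prod_XsubC //.
  by rewrite fmorph_eq0 lead_coef_eq0.
exists (map (@complex.Re R) r).
  apply: (map_poly_inj toC); rewrite er map_polyZ /=; congr (_ *: _).
  rewrite /roots_poly rmorph_prod -{1}hs !big_map; apply: eq_bigr => z _.
  by rewrite /= map_polyXsubC.
rewrite size_map -(size_map_poly toC p) er size_scale ?size_prod_XsubC //.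
by rewrite fmorph_eq0 lead_coef_eq0.
Qed.
End Interlacing.

(** * Continuants and the reconstruction of a Jacobi matrix *)

Section Parity.
Variable R : comNzRingType.
Implicit Types (p q : {poly R}).

(** Only the exponents congruent to n modulo 2 occur.  This encodes that the
    diagonal of the matrices under construction is zero. *)
Definition has_parity n p := forall i, odd i != odd n -> p`_i = 0.

Lemma has_parity_mulX n p : has_parity n p -> has_parity n.+1 ('X * p).
Proof.
move=> h [|i]; rewrite coefXM //= => hi; apply: h.
by move: hi; case: (odd i); case: (odd n).
Qed.

Lemma has_parityB n p q : has_parity n p -> has_parity n q -> has_parity n (p - q).
Proof. by move=> hp hq i hi; rewrite coefB hp // hq // subrr. Qed.

Lemma has_parityZ n c p : has_parity n p -> has_parity n (c *: p).
Proof. by move=> hp i hi; rewrite coefZ hp // mulr0. Qed.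

Lemma has_parity_deriv n p : has_parity n.+1 p -> has_parity n p^`().
Proof.
move=> hp i hi; rewrite coef_deriv hp ?mul0rn //=.
by move: hi; case: (odd i); case: (odd n).
Qed.

Lemma has_parity_eq n m p : odd n = odd m -> has_parity n p -> has_parity m p.
Proof. by move=> e hp i; rewrite -e; apply: hp. Qed.

Lemma has_parity_opp n p x : has_parity n p -> p.[- x] = (-1) ^+ n * p.[x].
Proof.
move=> hp; rewrite !horner_coef mulr_sumr; apply: eq_bigr => i _.
have [/eqP e|e] := boolP (odd i == odd n); last by rewrite hp // !mul0r mulr0.
have <- : (-1) ^+ i = (-1) ^+ n :> R by rewrite -signr_odd e signr_odd.
by rewrite [(- x) ^+ i]exprNn mulrCA.
Qed.
End Parity.

Section Chain.
Variables (T : comNzRingType) (t : T).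

(** Three-term recurrence of the determinants of tridiagonal matrices with
    diagonal t and products of opposite off-diagonal entries ws.  From (t, 1)
    it gives the continuant of a path and that of the path without its first
    vertex; from (1, 0), the same for the path deprived of its last vertex. *)
Definition chain (ab : T * T) (ws : seq T) : T * T :=
  foldr (fun w ab => (t * ab.1 - w * ab.2, ab.1)) ab ws.

(** The recurrence is a product of 2 x 2 matrices of determinant w; this is the
    multiplicativity of the determinant. *)
Lemma chain_wronskian ab cd ws :
  (chain ab ws).1 * (chain cd ws).2 - (chain ab ws).2 * (chain cd ws).1 =
  (ab.1 * cd.2 - ab.2 * cd.1) * \prod_(w <- ws) w.
Proof.
elim: ws => [|w ws IH] /=; first by rewrite big_nil mulr1.
by rewrite big_cons mulrCA -IH; ring.
Qed.
End Chain.

Section JacobiInverse.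
Variable R : rcfType.
Local Notation toC := (real_complex R).

(** Inverse problem for Jacobi matrices with zero diagonal, by the Euclidean
    algorithm: interlacing passes from (Q, K) to (K, X K - Q), because at the
    roots of K the Wronskian of Q and K is - Q K^'. *)
Lemma jacobi_chain N s (K : {poly R}) : size s = N.+1 -> uniq s ->
  residue_pos s K -> K \is monic -> has_parity N.+1 (roots_poly s) ->
  has_parity N K ->
  exists ps : seq R, [/\ size ps = N, all (fun w => 0 < w) ps &
    chain 'X ('X, 1) (map polyC ps) = (roots_poly s, K)].
Proof.
elim: N s K => [|N IH] s K sz us rK mK pQ pK.
  case: s sz us rK pQ => // m [|//] _ _ [sK _] pQ; exists [::]; split => //=.
  have := pQ 0%N isT; rewrite /roots_poly big_seq1 coefB coefX coefC /= sub0r.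
  move/eqP; rewrite oppr_eq0 => /eqP ->; rewrite subr0.
  have /size1_polyC eK := sK; move: mK; rewrite eK monicE lead_coefC => /eqP->.
  by [].
have sn : s != [::] by rewrite -size_eq0 sz.
have K0 : K != 0 by apply: monic_neq0.
have KN : 0 < K`_N.+1 by have := residue_pos_lead us rK sn; rewrite sz.
have sK : size K = N.+2.
  apply/eqP; rewrite eqn_leq; have [+ _] := rK; rewrite sz => -> /=.
  by rewrite ltnNge; apply/negP => /leq_sizeP/(_ _ (leqnn _)) h; rewrite h ltxx in KN.
have [s' eK sz'] := real_rooted_split (fun z => @residue_pos_real_roots R s K z us rK sn) K0.
rewrite (eqP mK) scale1r in eK; rewrite sK /= in sz'.
have W x : x \in s' -> 0 < - ((roots_poly s).[x] * K^`().[x]).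
  move=> xs; have := residue_pos_wronskian x us rK sn.
  have /eqP -> : K.[x] == 0 by rewrite eK roots_poly_eq0.
  by rewrite mulr0 sub0r.
have us' : uniq s'.
  apply: simple_roots_uniq => x /W; rewrite -eK; apply: contraTneq => ->.
  by rewrite mulr0 oppr0 ltxx.
(* The Euclidean remainder: the top coefficients cancel and parity kills the
   next one, so its degree drops by two. *)
pose Z := 'X * K - roots_poly s.
have pZ : has_parity N.+2 Z by apply: has_parityB => //; apply: has_parity_mulX.
have sZ : (size Z <= N.+1)%N.
  apply/leq_sizeP => j; rewrite leq_eqVlt => /predU1P[<-|].
    by apply: pZ => /=; case: (odd N).
  rewrite leq_eqVlt => /predU1P[<-|hj].
    have eQ : (roots_poly s)`_N.+2 = 1.
      have := monic_prod_XsubC s xpredT id; rewrite monicE -/(roots_poly s).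
      by rewrite lead_coefE size_roots_poly sz => /eqP.
    rewrite coefB coefXM /= eQ; move: mK; rewrite monicE lead_coefE sK /= => /eqP->.
    by rewrite subrr.
  rewrite coefB coefXM; case: j hj => // j hj /=.
  by rewrite !nth_default ?subrr ?sK ?size_roots_poly ?sz.
have rZ : residue_pos s' Z.
  split; first by rewrite sz'.
  move=> x xs; rewrite !hornerE -eK.
  have /eqP -> : K.[x] == 0 by rewrite eK roots_poly_eq0.
  by rewrite mulr0 sub0r mulNr W.
have sn' : s' != [::] by rewrite -size_eq0 sz'.
have p0 : 0 < Z`_N by have := residue_pos_lead us' rZ sn'; rewrite sz'.
set p := Z`_N in p0.
have sZ' : size Z = N.+1.
  apply/eqP; rewrite eqn_leq sZ /= ltnNge.
  by apply/negP => /leq_sizeP/(_ _ (leqnn _)) h; rewrite /p h ltxx in p0.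
have [||||ps [sps pps cps]] := IH s' (p^-1 *: Z) sz' us'.
- split; first by rewrite (leq_trans (size_scale_leq _ _)) // rZ.1.
  move=> x xs; rewrite hornerZ -mulrA mulr_gt0 ?invr_gt0 //; exact: rZ.2.
- rewrite monicE lead_coefZ lead_coefE sZ' /= -/p mulVf //; exact: lt0r_neq0.
- by rewrite -eK.
- by apply: has_parityZ; apply: (@has_parity_eq _ N.+2) => //=; rewrite negbK.
exists (p :: ps); split; rewrite /= ?sps ?p0 //.
rewrite cps -eK /=; congr (_, _).
rewrite mul_polyC scalerA divff ?scale1r; last exact: lt0r_neq0.
by rewrite /Z opprB addrC subrK.
Qed.
End JacobiInverse.

(** * Periodic weights with a prescribed discriminant polynomial *)

Section CyclicWeights.
Variable R : rcfType.
Local Notation toC := (real_complex R).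
Implicit Types (P : {poly R}).

Definition real_rooted P :=
  forall z, root (map_poly toC P) z -> z \is Num.real.

(** P is the characteristic polynomial of a periodic tridiagonal matrix with zero
    diagonal, up to the two products around the cycle: p0 and pl are the weights
    of the two edges at the distinguished vertex, ps those of the remaining path,
    and b2 is the product of all weights. *)
Definition cyclic_weights n P (b2 : R) :=
  exists p0 pl (ps : seq R), [/\ size ps = n, all (fun w => 0 <= w) [:: p0, pl & ps],
     p0 * pl * \prod_(w <- ps) w = b2 &
     let QK := chain 'X ('X, 1) (map polyC ps) in
     let L := (chain 'X (1, 0) (map polyC ps)).1 in
     P = 'X * QK.1 - p0 *: QK.2 - pl *: L].

(** The weights r, 0, r, 0, ... disconnect the path into blocks of size 2, each
    contributing X^2 - r. *)
Lemma chain_dominoes (ab : {poly R} * {poly R}) (rs : seq R) :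
  (chain 'X ab (map polyC (flatten [seq [:: r; 0] | r <- rs]))).1 =
  (roots_poly rs \Po 'X^2) * ab.1.
Proof.
elim: rs => [|r rs IH] /=; first by rewrite /roots_poly big_nil -polyC1 comp_polyC mul1r.
rewrite IH roots_poly_cons comp_polyM comp_polyB comp_polyX comp_polyC polyC0.
by ring.
Qed.

(** A real-rooted P with parity is X^(0 or 1) times E(X^2), and the roots of E are
    squares of roots of P, hence nonnegative.  They serve as the weights of
    decoupled blocks of size 2. *)
Lemma path_weights_split n P : size P = n.+3 -> P \is monic -> has_parity n.+2 P ->
  real_rooted P -> exists ws : seq R, [/\ size ws = n.+1, all (fun w => 0 <= w) ws &
    (chain 'X ('X, 1) (map polyC ws)).1 = P].
Proof.
move=> sP mP pP hP.
have [E [sE hE eP]] : exists E : {poly R}, [/\ size E = (n.+2)./2.+1,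
   forall z : R[i], root (map_poly toC E) (z ^+ 2) -> root (map_poly toC P) z
   & P = 'X^(odd n) * (E \Po 'X^2)].
  have := poly_even_odd P; case: (boolP (odd n)) => on eP.
    exists (odd_poly P); split; last 1 first.
    - rewrite -{1}eP; have -> : even_poly P = 0.
        apply/polyP => i; rewrite coef_even_poly coef0; apply: pP.
        by rewrite odd_double /= negbK on.
      by rewrite comp_poly0 add0r mulrC.
    - by rewrite size_odd_poly_eq sP /= ?negbK ?uphalf_half on.
    move=> z /eqP Ez; rewrite -eP; have -> : even_poly P = 0.
      apply/polyP => i; rewrite coef_even_poly coef0; apply: pP.
      by rewrite odd_double /= negbK on.
    rewrite comp_poly0 add0r /root rmorphM /= map_comp_poly map_polyXn map_polyX.
    by rewrite hornerM horner_comp hornerXn Ez mul0r.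
  have o0 : odd_poly P = 0.
    apply/polyP => i; rewrite coef_odd_poly coef0; apply: pP.
    by rewrite /= odd_double /= negbK (negbTE on).
  exists (even_poly P); split; last 1 first.
  - by rewrite -{1}eP o0 comp_poly0 mul0r addr0 expr0 mul1r.
  - by rewrite size_even_poly_eq sP //= ?(negbTE on) // uphalf_half /= (negbTE on).
  move=> z /eqP Ez; rewrite -eP o0 comp_poly0 mul0r addr0 /root.
  by rewrite map_comp_poly map_polyXn horner_comp hornerXn Ez.
have E0 : E != 0 by rewrite -size_poly_eq0 sE.
have rE (z : R[i]) : root (map_poly toC E) z -> 0 <= z.
  rewrite -(sqr_sqrtc z) => /hE/hP; rewrite realE => /orP[h|h].
    by rewrite exprn_ge0.
  by rewrite -sqrrN exprn_ge0 // oppr_ge0.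
have [rs eE srs] := real_rooted_split (fun z h => ger0_real (rE z h)) E0.
rewrite sE /= in srs.
have rs_ge0 : all (fun r => 0 <= r) rs.
  apply/allP => r rr; have := rE (toC r); rewrite -ler0c; apply.
  rewrite fmorph_root eE rootZ ?lead_coef_eq0 //; by rewrite /root roots_poly_eq0.
have eP' : P = 'X^(odd n) * (roots_poly rs \Po 'X^2).
  suff -> : roots_poly rs = E by [].
  rewrite [RHS]eE; suff -> : lead_coef E = 1 by rewrite scale1r.
  move: mP; rewrite eP monicE lead_coefM lead_coefXn mul1r lead_coef_comp ?size_polyXn //.
  by rewrite lead_coefXn expr1n mulr1 => /eqP.
have fl_ge0 (l : seq R) : all (fun r => 0 <= r) l ->
    all (fun w => 0 <= w) (flatten [seq [:: r; 0] | r <- l]).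
  by elim: l => //= r l IH /andP[-> /IH ->]; rewrite lexx.
have fl_size (l : seq R) : size (flatten [seq [:: r; 0] | r <- l]) = (size l).*2.
  by elim: l => //= r l ->.
have on : n = (odd n + (n./2).*2)%N by rewrite odd_double_half.
case: (boolP (odd n)) => o; rewrite ?o ?(negbTE o) in eP' on.
  exists (flatten [seq [:: r; 0] | r <- rs]); split.
  - by rewrite fl_size srs /= doubleS {2}on.
  - exact: fl_ge0.
  by rewrite chain_dominoes eP' mulrC.
(* For even size the last block ends the path, without a trailing weight 0. *)
case: rs srs rs_ge0 eP' {eE} => // r rs [srs] /andP[r0 rs0] eP'.
exists (rcons (flatten [seq [:: r; 0] | r <- rs]) r); split.
- by rewrite size_rcons fl_size srs {2}on.
- by rewrite all_rcons r0 fl_ge0.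
rewrite map_rcons /chain foldr_rcons -/(chain _ _ _) chain_dominoes eP' /=.
rewrite roots_poly_cons comp_polyM comp_polyB comp_polyX comp_polyC expr0.
by ring.
Qed.

(** a and d stand for the value and the second derivative at a critical point.  If
    a + 2b and a - 2b are both nonzero, they have the sign opposite to d. *)
Lemma sign_at_critical (a b d : R) : 0 < b ->
  (a + 2 * b != 0 -> (a + 2 * b) * d < 0) ->
  (a - 2 * b != 0 -> (a - 2 * b) * d < 0) ->
  4 * b ^+ 2 <= a ^+ 2 /\ a * d < 0.
Proof.
move=> b0 hp hm.
have [e|/hp {}hp] := eqVneq (a + 2 * b) 0.
  have ea : a = - 2 * b by lra.
  have /hm : a - 2 * b != 0 by rewrite ea; lra.
  by rewrite ea => h; split; [rewrite (_ : 4 * b ^+ 2 = (- 2 * b) ^+ 2) //; ring | nra].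
have [e|/hm {}hm] := eqVneq (a - 2 * b) 0.
  have ea : a = 2 * b by lra.
  by move: hp; rewrite ea => h; split; [rewrite (_ : 4 * b ^+ 2 = (2 * b) ^+ 2) //; ring | nra].
split; last by lra.
have d2 : 0 < ((a + 2 * b) * d) * ((a - 2 * b) * d) by rewrite nmulr_rgt0.
rewrite leNgt; apply/negP => h.
suff : ((a + 2 * b) * d) * ((a - 2 * b) * d) <= 0 by rewrite leNgt d2.
have -> : ((a + 2 * b) * d) * ((a - 2 * b) * d) = (a ^+ 2 - 4 * b ^+ 2) * d ^+ 2.
  by ring.
by rewrite mulr_le0_ge0 ?sqr_ge0 // subr_le0 ltW.
Qed.

(** Laguerre's inequality for P + 2b and P - 2b at a common critical point reduces
    to (P + c) P'' < 0, so P + 2b and P - 2b cannot have opposite signs there. *)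
Lemma critical_values n P b m : 0 < b -> size P = n.+3 -> P \is monic ->
  (forall c, c \in [:: 2 * b; - (2 * b)] -> real_rooted (P + c%:P)) ->
  P^`().[m] = 0 ->
  4 * b ^+ 2 <= P.[m] ^+ 2 /\ P.[m] * P^`()^`().[m] < 0.
Proof.
move=> b0 sP mP hP Pm.
have lag c : c \in [:: 2 * b; - (2 * b)] -> P.[m] + c != 0 ->
    (P.[m] + c) * P^`()^`().[m] < 0.
  move=> /hP rr h0.
  have sc : size (P + c%:P) = n.+3.
    by rewrite size_polyDl sP // (leq_ltn_trans (size_polyC_leq1 _)).
  have [|s eF ss] := real_rooted_split rr; first by rewrite -size_poly_eq0 sc.
  have lc : lead_coef (P + c%:P) = 1.
    rewrite lead_coefDl ?sP ?(leq_ltn_trans (size_polyC_leq1 _)) //.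
    exact/eqP.
  rewrite lc scale1r in eF.
  have [_] := laguerre s m; rewrite -eF derivD derivC addr0 !hornerE Pm.
  rewrite -size_eq0 ss sc => /(_ isT h0).
  by rewrite expr0n /= sub0r oppr_gt0.
apply: sign_at_critical => //; first by apply: lag; rewrite mem_head.
by apply: lag; rewrite !inE eqxx orbT.
Qed.

Lemma size_chain_lower (ps : seq R) :
  let ab := chain 'X ((1 : {poly R}), 0) (map polyC ps) in
  (size ab.1 <= (size ps).+1)%N /\ (size ab.2 <= size ps)%N.
Proof.
elim: ps => [|p ps [IH1 IH2]] /=; first by rewrite size_poly1 size_poly0.
split=> //; apply: leq_trans (size_polyD _ _) _; rewrite geq_max size_polyN.
rewrite mul_polyC (leq_trans (size_scale_leq _ _)) ?andbT; last first.
  by rewrite (leq_trans IH2) // ltnW.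
by rewrite mulrC; apply: leq_trans (size_polyMleq _ _) _; rewrite size_polyX addn2.
Qed.

(** The root of z^2 + a z + b^2 of larger absolute value.  Written this way it is an
    odd function of a, which keeps the interpolation below compatible with
    parity. *)
Lemma quadratic_choice (a b : R) : 0 < b -> 4 * b ^+ 2 <= a ^+ 2 ->
  let D := Num.sqrt (1 - 4 * b ^+ 2 / a ^+ 2) in
  let x := - (a / 2) * (1 + D) in
  x ^+ 2 + a * x + b ^+ 2 = 0 /\ (forall d, a * d < 0 -> 0 < x * d).
Proof.
move=> b0 h D x.
have a0 : a != 0.
  by apply: contraTneq h => ->; rewrite expr0n /= -ltNge mulr_gt0 ?exprn_gt0.
have D2 : D ^+ 2 = 1 - 4 * b ^+ 2 / a ^+ 2.
  by rewrite sqr_sqrtr // subr_ge0 ler_pdivrMr ?mul1r // exprn_even_gt0.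
have D0 : 0 <= D by exact: sqrtr_ge0.
split.
  have -> : x ^+ 2 + a * x + b ^+ 2 = a ^+ 2 / 4 * (D ^+ 2 - 1) + b ^+ 2.
    by rewrite /x; field.
  by rewrite D2; field.
move=> d ad; have -> : x * d = - (a * d) * ((1 + D) / 2) by rewrite /x; ring.
by rewrite mulr_gt0 ?oppr_gt0 // divr_gt0 // ltr_wpDr.
Qed.

(** With Q = P'/(n + 2), the polynomial p0 K is recovered from its values at the
    critical points of P. *)
Lemma cyclic_weights_pos n P b : 0 < b -> size P = n.+3 -> P \is monic ->
  has_parity n.+2 P ->
  (forall c, c \in [:: 0; 2 * b; - (2 * b)] -> real_rooted (P + c%:P)) ->
  cyclic_weights n P (b ^+ 2).
Proof.
move=> b0 sP mP pP hP.
have crit m : P^`().[m] = 0 -> 4 * b ^+ 2 <= P.[m] ^+ 2 /\ P.[m] * P^`()^`().[m] < 0.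
  by apply: (critical_values b0 sP mP) => c hc; apply: hP; rewrite inE hc orbT.
have rr0 : real_rooted P by rewrite -[P]addr0 -polyC0; apply: hP; rewrite mem_head.
have [sp eP ssp] := real_rooted_split rr0 (monic_neq0 mP).
rewrite (eqP mP) scale1r in eP; rewrite sP /= in ssp.
have P'x x : x \in sp -> P^`().[x] != 0.
  move=> xs; apply/negP => /eqP /crit[_].
  have /eqP -> : P.[x] == 0 by rewrite eP roots_poly_eq0.
  by rewrite mul0r ltxx.
have usp : uniq sp by apply: simple_roots_uniq => x; rewrite -eP; apply: P'x.
have rP' : residue_pos sp P^`().
  split; first by rewrite -ltnS ssp -sP lt_size_deriv ?monic_neq0.
  by move=> x xs; rewrite -eP -expr2 exprn_even_gt0 //= P'x.
have spn : sp != [::] by rewrite -size_eq0 ssp.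
have := residue_pos_lead usp rP' spn; rewrite ssp /=; set l0 := _`_ _ => l0_gt0.
have sP' : size P^`() = n.+2.
  apply/eqP; rewrite eqn_leq -{1}ssp rP'.1 /= ltnNge.
  by apply/negP => /leq_sizeP/(_ _ (leqnn _)) h; rewrite /l0 h ltxx in l0_gt0.
have P'0 : P^`() != 0 by rewrite -size_poly_eq0 sP'.
have [s eP' ss] := real_rooted_split
  (fun z => @residue_pos_real_roots R sp _ z usp rP' spn) P'0.
rewrite lead_coefE sP' /= -/l0 in eP'; rewrite sP' /= in ss.
have l0n : l0 != 0 by exact: lt0r_neq0.
set Q := roots_poly s in eP'.
have eQ : Q = l0^-1 *: P^`() by rewrite eP' scalerA mulVf // scale1r.
have pQ : has_parity n.+1 Q by rewrite eQ; apply/has_parityZ/has_parity_deriv.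
have scrit x : x \in s -> P^`().[x] = 0.
  by move=> xs; rewrite eP' hornerZ; have /eqP -> : Q.[x] == 0; rewrite ?roots_poly_eq0 ?mulr0.
(* The value that p0 K has to take at a critical point x. *)
pose g x := let a := P.[x] in
  - (a / 2) * (1 + Num.sqrt (1 - 4 * b ^+ 2 / a ^+ 2)).
have gP x : x \in s -> g x ^+ 2 + P.[x] * g x + b ^+ 2 = 0.
  by move=> /scrit/crit[h _]; have [] := quadratic_choice b0 h.
have gQ x : x \in s -> 0 < g x * Q^`().[x].
  move=> /scrit/crit[h hd]; have [_ /(_ _ hd)] := quadratic_choice b0 h.
  by rewrite eQ derivZ hornerZ [_ * (l0^-1 * _)]mulrCA [0 < l0^-1 * _]pmulr_rgt0 ?invr_gt0.
have us : uniq s.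
  by apply: simple_roots_uniq => x /gQ; apply: contraTneq => ->; rewrite mulr0 ltxx.
have [X sX hX] := interpolation g us.
have rX : residue_pos s X by split=> // x xs; rewrite hX // gQ.
have sn : s != [::] by rewrite -size_eq0 ss.
have gopp x : g (- x) = (-1) ^+ n * g x.
  rewrite /g (has_parity_opp _ pP) -(signr_odd _ n.+2) /= negbK signr_odd.
  by rewrite exprMn sqrr_sign mul1r; ring.
(* X and its reflection take the same values at the critical points, a set
   stable under negation. *)
have pX : has_parity n X.
  pose Xt := (-1) ^+ n *: \poly_(i < size X) ((-1) ^+ i * X`_i).
  have hXt x : Xt.[x] = (-1) ^+ n * X.[- x].
    rewrite hornerZ horner_poly horner_coef; congr (_ * _).
    by apply: eq_bigr => i _; rewrite [(- x) ^+ i]exprNn mulrA [_ * X`_i]mulrC -!mulrA.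
  have eX : Xt = X.
    apply: (poly_eq_on_roots us) => //.
      by apply: leq_trans (size_scale_leq _ _) (leq_trans (size_poly _ _) _).
    move=> x xs; rewrite hXt !hX //; last first.
      rewrite -roots_poly_eq0 -/Q (has_parity_opp _ pQ).
      by have /eqP -> : Q.[x] == 0; rewrite ?roots_poly_eq0 ?mulr0.
    by rewrite gopp mulrA -expr2 sqrr_sign mul1r.
  move=> i hi; have : X`_i = - X`_i.
    rewrite -{1}eX coefZ coef_poly; case: ltnP => hs; last by rewrite nth_default ?mulr0 ?oppr0.
    rewrite mulrA -exprD -signr_odd oddD addbC.
    by move: hi; case: (odd i); case: (odd n) => //= _; rewrite expr1 mulN1r.
  by move=> h; lra.
have := residue_pos_lead us rX sn; rewrite ss /=; set p0 := X`_n => p0_gt0.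
have p0n : p0 != 0 by exact: lt0r_neq0.
have sXn : size X = n.+1.
  apply/eqP; rewrite eqn_leq -{1}ss sX ltnNge.
  by apply/negP => /leq_sizeP/(_ _ (leqnn _)) h; rewrite /p0 h ltxx in p0_gt0.
pose K := p0^-1 *: X.
have [||||ps [sps pps cps]] := @jacobi_chain R n s K ss us.
- split; first by rewrite (leq_trans (size_scale_leq _ _)).
  by move=> x xs; rewrite hornerZ -mulrA mulr_gt0 ?invr_gt0 //; apply: rX.2.
- by rewrite monicE lead_coefZ lead_coefE sXn /= mulVf.
- by [].
- exact: has_parityZ.
have pi_gt0 : 0 < \prod_(w <- ps) w.
  by rewrite big_seq; apply: prodr_gt0 => w /(allP pps).
set pi := \prod_(w <- ps) w in pi_gt0.
have pin : pi != 0 by exact: lt0r_neq0.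
set L := (chain 'X ((1 : {poly R}), 0) (map polyC ps)).1.
pose pl := b ^+ 2 / (p0 * pi).
have KL x : x \in s -> K.[x] * L.[x] = pi.
  move=> xs; have := chain_wronskian 'X ('X, (1 : {poly R})) (1, 0) (map polyC ps).
  rewrite cps -/L /= mulr0 mulr1 sub0r big_map => /(congr1 (horner^~ x)).
  rewrite -rmorph_prod -/pi /= !hornerE.
  have /eqP -> : (roots_poly s).[x] == 0 by rewrite roots_poly_eq0.
  by rewrite mul0r sub0r mulN1r => h; apply: oppr_inj.
exists p0, pl, ps; split=> //.
- rewrite /= (ltW p0_gt0) divr_ge0 ?sqr_ge0 ?mulr_ge0 ?ltW //=.
  by apply/allP => w /(allP pps)/ltW.
- by rewrite -/pi /pl; field; rewrite p0n pin.
rewrite cps /= -/L /K scalerA divff // scale1r.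
(* At a critical point x the left side is - P(x) - g(x) = b^2 / g(x), and L(x) is
   proportional to 1 / K(x), hence to 1 / g(x). *)
suff : 'X * Q - X - P = pl *: L by move=> <-; rewrite opprB addrC subrK.
have pZ : has_parity n.+2 ('X * Q - P) by apply: has_parityB => //; apply: has_parity_mulX.
apply: (poly_eq_on_roots us).
- rewrite ss addrAC; apply: leq_trans (size_polyD _ _) _.
  rewrite geq_max size_polyN sXn leqnn andbT; apply/leq_sizeP => j.
  rewrite leq_eqVlt => /predU1P[<-|].
    by apply: pZ => /=; case: (odd n).
  rewrite leq_eqVlt => /predU1P[<-|hj].
    have eQl : Q`_n.+1 = 1.
      have := monic_prod_XsubC s xpredT id; rewrite monicE -/(roots_poly s).
      by rewrite lead_coefE size_roots_poly ss => /eqP.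
    rewrite coefB coefXM /= eQl; move: mP; rewrite monicE lead_coefE sP /= => /eqP->.
    by rewrite subrr.
  rewrite coefB coefXM; case: j hj => // j hj /=.
  by rewrite !nth_default ?subrr ?sP ?size_roots_poly ?ss.
- rewrite ss (leq_trans (size_scale_leq _ _)) // -sps.
  by have [] := size_chain_lower ps.
move=> x xs; rewrite !hornerE; have /eqP -> : Q.[x] == 0 by rewrite roots_poly_eq0.
have gn : g x != 0 by apply: contraTneq (gQ x xs) => ->; rewrite mul0r ltxx.
have gK : g x = p0 * K.[x] by rewrite hornerZ mulrA divff // mul1r hX.
have Kn : K.[x] != 0 by move: gn; rewrite gK mulf_eq0 negb_or => /andP[].
have -> : L.[x] = pi / K.[x] by rewrite -(KL x xs) mulrAC divff ?mul1r.
have -> : pl * (pi / K.[x]) = b ^+ 2 / g x.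
  by rewrite /pl gK; field; rewrite p0n pin Kn.
have := gP x xs; rewrite hX // => h.
apply: (mulIf gn); rewrite divfK //.
rewrite mulr0 sub0r; apply/eqP; rewrite -subr_eq0 -[X in _ == X]oppr0 -h.
by apply/eqP; ring.
Qed.

Lemma cyclic_weights_exist n P b : 0 <= b -> size P = n.+3 -> P \is monic ->
  has_parity n.+2 P ->
  (forall c, c \in [:: 0; 2 * b; - (2 * b)] -> real_rooted (P + c%:P)) ->
  cyclic_weights n P (b ^+ 2).
Proof.
rewrite le_eqVlt => /predU1P[<-|b0]; last exact: cyclic_weights_pos.
move=> sP mP pP hP.
have rr0 : real_rooted P by rewrite -[P]addr0 -polyC0; apply: hP; rewrite mem_head.
have [[|w ws] [// [sw] aw eP]] := path_weights_split sP mP pP rr0.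
exists w, 0, ws; split=> //.
- by move: aw => /= /andP[-> ->]; rewrite lexx.
- by rewrite mulr0 mul0r expr0n.
by rewrite -eP /= scale0r subr0 mul_polyC.
Qed.
End CyclicWeights.

(** * The determinant of a periodic tridiagonal matrix *)

Section Tridiagonal.
Variables (T : comNzRingType) (t : T).
Implicit Types (a c : nat -> T).

Definition tridiag m a c : 'M[T]_m :=
  \matrix_(i, j) (if i == j :> nat then t else if j == i.+1 :> nat then a i
                  else if i == j.+1 :> nat then c j else 0).

Definition shift (a : nat -> T) i := a i.+1.

Lemma tridiag_tr m a c : (tridiag m a c)^T = tridiag m c a.
Proof.
apply/matrixP => i j; rewrite !mxE eq_sym; case: eqP => // _.
by case: eqP => [->|//]; case: eqP => // e; lia.
Qed.

Lemma tridiag_minor0 m a c :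
  row' ord0 (col' ord0 (tridiag m.+1 a c)) = tridiag m (shift a) (shift c).
Proof. by apply/matrixP => i j; rewrite !mxE /= /bump !add1n !eqSS. Qed.

Lemma tridiag_minor_max m a c :
  row' ord_max (col' ord_max (tridiag m.+1 a c)) = tridiag m a c.
Proof. by apply/matrixP => i j; rewrite !mxE !lift_max. Qed.

Lemma det_tridiag_rec m a c : \det (tridiag m.+2 a c) =
  t * \det (tridiag m.+1 (shift a) (shift c)) -
  a 0%N * c 0%N * \det (tridiag m (shift (shift a)) (shift (shift c))).
Proof.
rewrite (expand_det_row _ ord0) big_ord_recl big_ord_recl /= big1 => [|i _]; last first.
  by rewrite !mxE /= mul0r.
rewrite addr0 /cofactor tridiag_minor0 !mxE /= expr0 mul1r; congr (_ + _).
rewrite /bump /= addn0 expr1 mulN1r mulrN; congr (- _).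
rewrite (expand_det_col _ ord0) big_ord_recl big1 => [|i _]; last first.
  by rewrite !mxE /= /bump /= mul0r.
rewrite addr0 !mxE /= mulrA; congr (_ * _).
rewrite /cofactor /= expr0 mul1r; congr (\det _).
by apply/matrixP => i j; rewrite !mxE /= /bump /= !add1n.
Qed.

Lemma mkseq_shift (f : nat -> T) m : mkseq f m.+1 = f 0%N :: mkseq (shift f) m.
Proof. by rewrite /mkseq /= -[1%N]addn0 iotaDl -map_comp. Qed.

Lemma chain_tridiag m a c :
  chain t (t, 1) (mkseq (fun i => a i * c i) m) =
  (\det (tridiag m.+1 a c), \det (tridiag m (shift a) (shift c))).
Proof.
elim: m a c => [|m IH] a c.
  by rewrite /= det_mx00 det_mx11 mxE.
by rewrite mkseq_shift /= (IH (shift a) (shift c)) det_tridiag_rec.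
Qed.

Lemma chain_tridiag_last m a c :
  (chain t (1, 0) (mkseq (fun i => a i * c i) m)).1 = \det (tridiag m a c).
Proof.
case: m => [|m]; first by rewrite det_mx00.
by rewrite mkseqS /chain foldr_rcons /= mulr1 mulr0 subr0 -/(chain _ _ _) chain_tridiag.
Qed.

(** Deleting the last row and the first column of a tridiagonal matrix leaves a
    triangular one, with the superdiagonal on its diagonal. *)
Lemma adj_tridiag_corner m a c :
  (\adj (tridiag m.+1 a c)) ord0 ord_max = (-1) ^+ m * \prod_(i < m) a i.
Proof.
rewrite mxE /cofactor addn0 /=; congr (_ * _); rewrite det_trig.
  by apply: eq_bigr => i _; rewrite !mxE lift_max /= /bump /= add1n eqxx ltn_eqF.
apply/is_trig_mxP => i j ij; rewrite !mxE lift_max /= /bump /= !add1n.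
by do 3?[case: eqP => [?|_]; first by lia].
Qed.
End Tridiagonal.

Section CyclicDeterminant.
Variables (T : idomainType) (t : T).
Implicit Types (a c : nat -> T).

(** Schur complement without inverses, by multiplying with the block matrix whose
    first column is (det D, - adj(D) c). *)
Lemma det_bordered m (r : 'rV[T]_m) (c : 'cV[T]_m) (D : 'M[T]_m) :
  \det D != 0 ->
  \det (block_mx t%:M r c D) = t * \det D - (r *m \adj D *m c) 0 0.
Proof.
move=> D0; apply: (mulIf D0).
have := det_mulmx (block_mx t%:M r c D) (block_mx (\det D)%:M 0 (- (\adj D *m c)) 1%:M).
rewrite det_lblock det1 mulr1 det_scalar expr1 => <-.
rewrite mulmx_block !mulmx0 !mulmx1 !add0r !mul_mx_scalar !mulmxN !mulmxA mul_mx_adj.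
rewrite mul_scalar_mx.
have -> : \det D *: c - \det D *: c = 0 by rewrite subrr.
rewrite det_ublock det_mx11; congr (_ * _).
by rewrite !mxE eqxx mulr1n mulrC.
Qed.

Definition cyclic_tridiag n (a c : 'I_n -> T) : 'M[T]_n :=
  t%:M + cyclic_shift a + (cyclic_shift c)^T.

Lemma modn_cycle_succ m (j : 'I_m.+1) :
  ((1 + j).+1 %% m.+2)%N = if j == m :> nat then 0%N else j.+2.
Proof.
rewrite add1n; case: eqP => [->|/eqP jm]; first by rewrite modnn.
by rewrite modn_small // !ltnS ltn_neqAle jm -ltnS ltn_ord.
Qed.

(** Expansion along the row and column of one vertex of the cycle: the diagonal
    entries of the adjugate of the remaining path give the continuants, its corner
    entries give the two products around the cycle.  The nonvanishing hypothesis
    serves to cancel in [det_bordered]. *)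
Lemma det_cyclic_tridiag (w0 wl : T) m a c ws :
  mkseq (fun i => a i.+1 * c i.+1) m = ws -> a 0%N * c 0%N = w0 ->
  a m.+1 * c m.+1 = wl -> (chain t (t, 1) ws).1 != 0 ->
  \det (cyclic_tridiag (fun i : 'I_m.+2 => a i) (fun i => c i)) =
    t * (chain t (t, 1) ws).1 - w0 * (chain t (t, 1) ws).2
    - wl * (chain t (1, 0) ws).1
    + (-1) ^+ m.+1 * (\prod_(i < m.+2) a i + \prod_(i < m.+2) c i).
Proof.
move=> <- <- <-; rewrite (chain_tridiag t m (shift a) (shift c)).
rewrite (chain_tridiag_last t m (shift a) (shift c)) /= => D0.
pose r : 'rV[T]_m.+1 := a 0%N *: delta_mx 0 ord0 + c m.+1 *: delta_mx 0 ord_max.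
pose l : 'cV[T]_m.+1 := c 0%N *: delta_mx ord0 0 + a m.+1 *: delta_mx ord_max 0.
have -> : cyclic_tridiag a c = block_mx t%:M r l (tridiag t m.+1 (shift a) (shift c))
    :> 'M_(1 + m.+1).
  apply/matrixP => u v; rewrite -[u]splitK -[v]splitK.
  case: (split u) => i; case: (split v) => j /=;
    rewrite ?block_mxEul ?block_mxEur ?block_mxEdl ?block_mxEdr !mxE ?ord1 /=.
  - by rewrite !addr0.
  - rewrite mulr0n add0r -!val_eqE /= modn_small // eqSS eq_sym.
    rewrite [X in _ + X](_ : _ = c m.+1 * (j == ord_max)%:R).
      by rewrite eq_sym; case: (_ == _); rewrite ?mulr1 ?mulr0.
    rewrite (modn_cycle_succ j) -[j == _]val_eqE /=.
    by case: (eqVneq (j : nat) m) => [->|_] /=; rewrite ?add1n ?mulr1 ?mulr0.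
  - rewrite mulr0n add0r -!val_eqE /= (@modn_small 1) // eqSS !andbT addrC.
    rewrite (modn_cycle_succ i); congr (_ + _).
      by case: (_ == _); rewrite ?mulr1 ?mulr0.
    by case: (eqVneq (i : nat) m) => [->|_] /=; rewrite ?add1n ?mulr1 ?mulr0.
  rewrite -!val_eqE /= !modn_cycle_succ !add1n eqSS /shift.
  have [->|ij] := eqVneq (i : nat) j.
    have -> : (j.+1 == if j == m :> nat then 0%N else j.+2) = false.
      by case: (_ == m) => //; apply: ltn_eqF.
    by rewrite !addr0.
  rewrite [t *+ _]mulr0n add0r.
  have hj := ltn_ord j; have hi := ltn_ord i.
  case: (eqVneq (i : nat) m) => [im|im]; case: (eqVneq (j : nat) m) => [jm|jm] /=.
  - by case/eqP: ij; rewrite im jm.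
  - rewrite add0r eqSS [j == i.+1 :> nat]ltn_eqF //. lia.
  - rewrite addr0 eqSS; case: eqP => // _; rewrite ltn_eqF //; lia.
  rewrite !eqSS; case: eqP => [e|_]; last by rewrite add0r.
  by rewrite ltn_eqF ?addr0 // e; lia.
rewrite det_bordered //.
have E i j : ((delta_mx 0 i : 'rV_m.+1) *m \adj (tridiag t m.+1 (shift a) (shift c)) *m
    (delta_mx j 0 : 'cV_m.+1)) 0 0 =
   (\adj (tridiag t m.+1 (shift a) (shift c))) i j.
  by rewrite -rowE -colE !mxE.
have ad0 : (\adj (tridiag t m.+1 (shift a) (shift c))) ord0 ord0 =
    \det (tridiag t m (shift (shift a)) (shift (shift c))).
  by rewrite mxE /cofactor tridiag_minor0 expr0 mul1r.
have adm : (\adj (tridiag t m.+1 (shift a) (shift c))) ord_max ord_max =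
    \det (tridiag t m (shift a) (shift c)).
  by rewrite mxE /cofactor tridiag_minor_max -signr_odd oddD addbb expr0 mul1r.
have adc : (\adj (tridiag t m.+1 (shift a) (shift c))) ord_max ord0 =
    (-1) ^+ m * \prod_(i < m) shift c i.
  rewrite -(adj_tridiag_corner t m (shift c) (shift a)) -(tridiag_tr t m.+1 (shift a)) -trmx_adj.
  by rewrite [RHS]mxE.
have -> : (r *m \adj (tridiag t m.+1 (shift a) (shift c)) *m l) 0 0 =
   a 0%N * c 0%N * \det (tridiag t m (shift (shift a)) (shift (shift c))) +
   c m.+1 * a m.+1 * \det (tridiag t m (shift a) (shift c)) +
   (a 0%N * a m.+1 * ((-1) ^+ m * \prod_(i < m) shift a i)
   + c m.+1 * c 0%N * ((-1) ^+ m * \prod_(i < m) shift c i)).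
  rewrite -ad0 -adm -adc -(adj_tridiag_corner t m (shift a) (shift c)) -!E.
  rewrite /r /l !(mulmxDl, mulmxDr, =^~ scalemxAl, =^~ scalemxAr).
  by rewrite !mxE; ring.
rewrite 2!(@big_ord_recl _ _ _ m.+1) 2!(@big_ord_recr _ _ _ m) /= exprS /shift /bump /=.
by ring.
Qed.
End CyclicDeterminant.

(** * Multivariate polynomials: substitution and homogenization *)

Lemma ord3P (Q : 'I_3 -> Prop) : Q 0 -> Q 1 -> Q 2 -> forall i, Q i.
Proof.
move=> Q0 Q1 Q2 [[|[|[|//]]] hi].
- by rewrite (_ : Ordinal hi = 0) //; apply: val_inj.
- by rewrite (_ : Ordinal hi = 1) //; apply: val_inj.
- by rewrite (_ : Ordinal hi = 2) //; apply: val_inj.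
Qed.

Lemma big_ord3 (T : Type) (idx : T) (op : Monoid.law idx) (h : 'I_3 -> T) :
  \big[op/idx]_i h i = op (h 0) (op (h 1) (h 2)).
Proof.
rewrite !big_ord_recl big_ord0 Monoid.mulm1.
by congr (op _ (op _ _)); congr h; apply: val_inj.
Qed.

Section MpolyGeneral.
Variables (d : nat).

(** Universal property: the many identities between evaluations, substitutions and
    coefficient changes below are reduced to constants and variables by it. *)
Lemma rmorph_mpoly_eq (A : nzRingType) (B : nzRingType) (f g : {rmorphism {mpoly A[d]} -> B}) :
  (forall c, f c%:MP = g c%:MP) -> (forall i, f 'X_i = g 'X_i) -> f =1 g.
Proof.
move=> hc hX p; rewrite (mpolyE p) !rmorph_sum; apply: eq_bigr => m _.
rewrite -mul_mpolyC !rmorphM hc mpolyXE_id !rmorph_prod; congr (_ * _).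
by apply: eq_bigr => i _; rewrite !rmorphXn hX.
Qed.

Variable A : comNzRingType.

Lemma mcoeff_sum_monomials (s : seq 'X_{1..d}) (h : 'X_{1..d} -> A) m : uniq s ->
  (\sum_(m' <- s) h m' *: 'X_[m'])@_m = if m \in s then h m else 0.
Proof.
move=> us; rewrite raddf_sum /=; case: ifP => ms.
  rewrite (bigD1_seq m) //= mcoeffZ mcoeffX eqxx mulr1 big1 ?addr0 // => m' /negbTE e.
  by rewrite mcoeffZ mcoeffX e mulr0.
rewrite big_seq big1 // => m' m's; rewrite mcoeffZ mcoeffX.
by case: eqP => [e|_]; rewrite ?mulr0 //; rewrite -e m's in ms.
Qed.

Lemma mpoly_sum_supp (s : seq 'X_{1..d}) (p : {mpoly A[d]}) : uniq s ->
  (forall m, m \notin s -> p@_m = 0) -> p = \sum_(m <- s) p@_m *: 'X_[m].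
Proof.
move=> us hp; apply/mpolyP => m; rewrite (mcoeff_sum_monomials (fun m => p@_m)) //.
by case: ifP => // /negbT/hp.
Qed.

Lemma mcoeff_diag (s : 'I_d -> A) (p : {mpoly A[d]}) m :
  (comp_mpoly [tuple s i *: 'X_i | i < d] p)@_m = p@_m * \prod_i s i ^+ m i.
Proof.
rewrite comp_mpolyEX.
rewrite (eq_bigr (fun m => (p@_m * \prod_i s i ^+ m i) *: 'X_[m])) => [|m' _].
  rewrite (mcoeff_sum_monomials (fun m => p@_m * \prod_i s i ^+ m i)) ?msupp_uniq //.
  by rewrite mcoeff_msupp; case: eqP => //= ->; rewrite mul0r.
rewrite comp_mpolyX -scalerA mpolyXE_id; congr (_ *: _).
rewrite -mul_mpolyC rmorph_prod -big_split; apply: eq_bigr => i _.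
by rewrite tnth_mktuple -mul_mpolyC exprMn rmorphXn.
Qed.

Lemma comp_mpolyA k l (p : {mpoly A[d]}) (q : d.-tuple {mpoly A[k]}) (r : k.-tuple {mpoly A[l]}) :
  comp_mpoly r (comp_mpoly q p) = comp_mpoly [tuple comp_mpoly r (tnth q i) | i < d] p.
Proof.
apply: (rmorph_mpoly_eq (f := comp_mpoly r \o comp_mpoly q)) => [c|i] /=.
  by rewrite !comp_mpolyC.
by rewrite !comp_mpolyXU -!tnth_nth tnth_mktuple.
Qed.

Lemma dhomog_comp_linear k n (p : {mpoly A[d]}) (q : d.-tuple {mpoly A[k]}) :
  p \is n.-homog -> (forall i, tnth q i \is 1.-homog) -> comp_mpoly q p \is n.-homog.
Proof.
move=> hp hq; rewrite comp_mpolyEX big_seq; apply: rpred_sum => m ms.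
apply: dhomogZ; rewrite comp_mpolyX.
have <- : mdeg m = n := dhomog_mf hp ms.
rewrite mdegE; elim/big_rec2: _ => [|i e p' _ hp']; first exact: dhomog1.
by apply: dhomogM => //; rewrite -[X in X.-homog]mul1n; apply: dhomogMn.
Qed.

Lemma dhomog_meval n (p : {mpoly A[d]}) c (v w : 'I_d -> A) : p \is n.-homog ->
  (forall i, w i = c * v i) -> p.@[w] = c ^+ n * p.@[v].
Proof.
move=> hp hw; rewrite !mevalE mulr_sumr big_seq [RHS]big_seq.
apply: eq_bigr => m ms; rewrite mulrCA; congr (_ * _).
have <- : mdeg m = n := dhomog_mf hp ms.
rewrite mdegE -prodrXr -big_split; apply: eq_bigr => i _.
by rewrite hw exprMn.
Qed.

End MpolyGeneral.

Section Homogenization.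
Variables (K T : comNzRingType) (phi : {rmorphism K -> T}) (t w : T).

(** Degree n homogenization of p in a variable t of weight 1 and a variable w of
    weight 2; only the coefficients of p with the parity of n enter. *)
Definition homogenize n (p : {poly K}) : T :=
  \sum_(k < n./2.+1) phi p`_(n - k.*2) * t ^+ (n - k.*2) * w ^+ k.

Lemma homogenizeB n (p q : {poly K}) : homogenize n (p - q) = homogenize n p - homogenize n q.
Proof.
by rewrite /homogenize -sumrB; apply: eq_bigr => k _; rewrite coefB rmorphB !mulrBl.
Qed.

Lemma homogenizeZ n c (p : {poly K}) : homogenize n (c *: p) = phi c * homogenize n p.
Proof.
by rewrite /homogenize mulr_sumr; apply: eq_bigr => k _; rewrite coefZ rmorphM !mulrA.
Qed.

Lemma homogenize_mulX n (p : {poly K}) : homogenize n.+1 ('X * p) = t * homogenize n p.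
Proof.
rewrite /homogenize mulr_sumr.
have E k : (k.*2 <= n)%N -> phi ('X * p)`_(n.+1 - k.*2) * t ^+ (n.+1 - k.*2) * w ^+ k =
   t * (phi p`_(n - k.*2) * t ^+ (n - k.*2) * w ^+ k).
  by move=> hk; rewrite subSn // coefXM /= exprS; ring.
have lek (k : 'I_(n./2.+1)) : (k.*2 <= n)%N.
  by rewrite -geq_half_double -ltnS ltn_ord.
rewrite /=; case: (boolP (odd n)) => o; last first.
  by rewrite uphalf_half (negbTE o) add0n; apply: eq_bigr => k _; apply: E.
rewrite uphalf_half o add1n big_ord_recr /=.
have -> : (n.+1 - (n./2.+1).*2)%N = 0%N.
  by rewrite doubleS -{1}(odd_double_half n) o add1n subnn.
rewrite coefXM /= rmorph0 !mul0r addr0.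
by apply: eq_bigr => k _; apply: E.
Qed.

Lemma homogenize_mulw n (p : {poly K}) : (size p <= n.+2)%N -> w * homogenize n p = homogenize n.+2 p.
Proof.
move=> sp; rewrite /homogenize mulr_sumr /= [RHS]big_ord_recl /=.
rewrite subn0 nth_default // rmorph0 !mul0r add0r; apply: eq_bigr => k _.
by rewrite /bump /= add1n doubleS !subSS exprS; ring.
Qed.

(** Homogenization turns the recurrence with weights p into the one with weights
    p w.  The second components are compared after multiplication by w, which
    avoids a negative degree at the start of the recurrence from (1, 0). *)
Lemma homogenize_chain d (A0 B0 : {poly K}) (a0 b0 : T) (ps : seq K) :
  a0 = homogenize d A0 -> w * b0 = homogenize d.+1 B0 ->
  (size A0 <= d.+1)%N -> (size B0 <= d.+1)%N ->
  let AB := chain 'X (A0, B0) (map polyC ps) in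
  let ab := chain t (a0, b0) [seq phi p * w | p <- ps] in
  let m := (size ps + d)%N in
  [/\ ab.1 = homogenize m AB.1, w * ab.2 = homogenize m.+1 AB.2, (size AB.1 <= m.+1)%N
   & (size AB.2 <= m.+1)%N].
Proof.
move=> ha hb sA sB; elim: ps => [|p ps] //=.
set AB := chain 'X _ _; set ab := chain t _ _.
move=> [e1 e2 s1 s2]; split=> //.
- by rewrite homogenizeB homogenize_mulX mul_polyC homogenizeZ -e1 -e2; ring.
- by rewrite e1 homogenize_mulw // ltnW.
- apply: leq_trans (size_polyD _ _) _; rewrite geq_max size_polyN mul_polyC.
  rewrite (leq_trans (size_scale_leq _ _)) ?andbT; last by rewrite ltnW.
  by rewrite mulrC; apply: leq_trans (size_polyMleq _ _) _; rewrite size_polyX addn2.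
by rewrite ltnW.
Qed.
End Homogenization.

(** * Rotational symmetry in the coordinates u and v *)

Lemma map_comp_mpoly (A B : comNzRingType) k l (g : {rmorphism A -> B})
    (q : k.-tuple {mpoly A[l]}) p :
  map_mpoly g (comp_mpoly q p) =
  comp_mpoly [tuple map_mpoly g (tnth q i) | i < k] (map_mpoly g p).
Proof.
apply: (rmorph_mpoly_eq (f := map_mpoly g \o comp_mpoly q)
  (g := comp_mpoly _ \o map_mpoly g)) => [c|i] /=.
  by rewrite comp_mpolyC !map_mpolyC comp_mpolyC.
by rewrite map_mpolyX !comp_mpolyXU -!tnth_nth tnth_mktuple.
Qed.

Lemma dhomog_map_mpoly (A B : comNzRingType) k (g : {rmorphism A -> B}) n
    (p : {mpoly A[k]}) : p \is n.-homog -> map_mpoly g p \is n.-homog.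
Proof.
move=> hom; apply/dhomogP => m; rewrite mcoeff_msupp mcoeff_map_mpoly => hm.
apply: (dhomog_mf hom); rewrite mcoeff_msupp; apply: contraNneq hm => ->.
exact/eqP/rmorph0.
Qed.

Lemma comp_mpolyXi (A : comNzRingType) k l (q : k.-tuple {mpoly A[l]}) i :
  comp_mpoly q 'X_i = tnth q i.
Proof. by rewrite comp_mpolyXU -tnth_nth. Qed.

Lemma sum_same_parity (V : nmodType) (f : nat -> V) n :
  (forall i, odd i != odd n -> f i = 0) ->
  \sum_(i < n.+1) f i = \sum_(k < n./2.+1) f (n - k.*2)%N.
Proof.
elim/ltn_ind: n => -[|[|n]] IH hf.
- by rewrite !big_ord1.
- by rewrite big_ord_recl !big_ord1 hf // add0r.
rewrite 2!big_ord_recr /= (hf n.+1) /=; last by case: (odd n).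
rewrite addr0 (IH n) //; last by move=> i; rewrite -[odd n]negbK; apply: hf.
by rewrite [RHS]big_ord_recl /= subn0 addrC; congr (_ + _).
Qed.

Lemma rmorph_homogenize (K T S : comNzRingType) (phi : {rmorphism K -> T})
   (g : {rmorphism T -> S}) t w n p :
  g (homogenize phi t w n p) = homogenize (g \o phi) (g t) (g w) n p.
Proof.
by rewrite rmorph_sum; apply: eq_bigr => k _; rewrite !rmorphM !rmorphXn.
Qed.

Lemma homogenize_w1 (K : comNzRingType) n (p : {poly K}) :
  has_parity n p -> (size p <= n.+1)%N ->
  homogenize (@polyC K) 'X 1 n p = p.
Proof.
move=> pp sp; have ep : p = \sum_(i < n.+1) p`_i *: 'X^i.
  rewrite -poly_def; apply/polyP => i; rewrite coef_poly.
  by case: ltnP => // h; rewrite nth_default // (leq_trans sp).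
rewrite [RHS]ep.
rewrite (sum_same_parity (f := fun i => p`_i *: 'X^i)) => [|i hi]; last by rewrite (pp _ hi) scale0r.
by apply: eq_bigr => k _; rewrite expr1n mulr1 mul_polyC.
Qed.

Section Rotation.
Variable R : realType.
Local Notation C := R[i].
Local Notation toC := (real_complex R).
Local Notation iC := ('i%C : C).

Lemma expc_trig (x : R) k : (cos x +i* sin x)%C ^+ k = (cos (k%:R * x) +i* sin (k%:R * x))%C.
Proof.
elim: k => [|k IH]; first by rewrite mul0r cos0 sin0 expr0.
rewrite exprS IH -natr1 mulrDl mul1r addrC cosD sinD.
by apply/eqP; rewrite eq_complex /= eqxx /= addrC eqxx.
Qed.

(** The real part of the k-th power is cos(2y) = 1 - 2 sin(y)^2 with
    y = k pi / n strictly between 0 and pi. *)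
Lemma root_of_unity_order n k : (0 < k < n)%N ->
  (cos (2 * pi / n%:R) +i* sin (2 * pi / n%:R))%C ^+ k != 1 :> C.
Proof.
move=> /andP[k0 kn]; rewrite expc_trig; apply/negP => /eqP[+ _].
have n0 : 0 < n%:R :> R by rewrite ltr0n (leq_trans _ kn).
pose y : R := k%:R * pi / n%:R.
have -> : k%:R * (2 * pi / n%:R) = y *+ 2 by rewrite /y -mulr_natl; ring.
have ysin : 0 < sin y.
  apply: sin_gt0_pi; rewrite divr_gt0 ?mulr_gt0 ?pi_gt0 ?ltr0n ?(leq_trans _ kn) //=.
  by rewrite ltr_pdivrMr ?ltr0n ?(leq_trans _ kn) // mulrC ltr_pM2l ?pi_gt0 // ltr_nat.
rewrite cos_mulr2n => h; have := cos2Dsin2 y.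
have : 0 < sin y ^+ 2 by rewrite exprn_gt0.
by move=> h1 h2; move: h h1 h2; lra.
Qed.

Definition mnm3 (a b c : nat) : 'X_{1..3} := Multinom [tuple a; b; c].

Lemma mnm3_eta (m : 'X_{1..3}) : m = mnm3 (m 0%R) (m 1%R) (m 2%R).
Proof. by apply/mnmP; apply: ord3P; rewrite [RHS]multinomE. Qed.

Lemma mdeg3 (m : 'X_{1..3}) : mdeg m = (m 0%R + m 1%R + m 2%R)%N.
Proof. by rewrite mdegE big_ord3 /= addnA. Qed.

Lemma mpolyX3 (A : nzRingType) a b c :
  'X_[mnm3 a b c] = 'X_0 ^+ a * 'X_1 ^+ b * 'X_2 ^+ c :> {mpoly A[3]}.
Proof. by rewrite mpolyXE_id big_ord3 /= !multinomE mulrA. Qed.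

(** A diagonal substitution multiplies each monomial by a scalar, which must be 1 on
    the support of an invariant polynomial. *)
Lemma diag_invariant_mcoeff (A : idomainType) (s1 s2 : A) (G : {mpoly A[3]}) a b c :
  comp_mpoly [tuple vec3 1 s1 s2 i *: 'X_i | i < 3] G = G ->
  G@_(mnm3 a b c) != 0 -> s1 ^+ b * s2 ^+ c = 1.
Proof.
move=> hG G0; have := congr1 (mcoeff (mnm3 a b c)) hG.
rewrite mcoeff_diag big_ord3 /= !multinomE.
rewrite -[RHS]mulr1 => /(mulfI G0).
by rewrite [tnth _ 0]/= [tnth _ 1]/= [tnth _ 2]/= expr1n mul1r.
Qed.

Definition uvar : {mpoly C[3]} := 'X_1 + iC *: 'X_2.
Definition vvar : {mpoly C[3]} := 'X_1 - iC *: 'X_2.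

Definition to_uv : 3.-tuple {mpoly C[3]} :=
  [tuple 'X_0; 2^-1 *: ('X_1 + 'X_2); (- iC / 2) *: ('X_1 - 'X_2)].
Definition from_uv : 3.-tuple {mpoly C[3]} := [tuple 'X_0; uvar; vvar].

Lemma iCiC : iC * iC = -1.
Proof. by rewrite -expr2 sqr_i. Qed.

Lemma to_uvK (F : {mpoly C[3]}) : comp_mpoly from_uv (comp_mpoly to_uv F) = F.
Proof.
rewrite comp_mpolyA -[RHS]comp_mpoly_id; congr (comp_mpoly _ F).
apply/eq_from_tnth; apply: ord3P; rewrite !tnth_mktuple ?comp_mpolyXi //.
- rewrite [tnth to_uv 1]/= comp_mpolyZ comp_mpolyD !comp_mpolyXi.
  rewrite [tnth from_uv 1]/= [tnth from_uv 2]/= /uvar /vvar addrACA subrr addr0.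
  by rewrite -mulr2n -(scaler_nat 2 ('X_1 : {mpoly C[3]})) scalerA mulVf ?scale1r ?pnatr_eq0.
rewrite [tnth to_uv 2]/= comp_mpolyZ comp_mpolyB !comp_mpolyXi.
rewrite [tnth from_uv 1]/= [tnth from_uv 2]/= /uvar /vvar opprB addrC addrA subrK.
rewrite -mulr2n -(scaler_nat 2 (iC *: 'X_2 : {mpoly C[3]})) !scalerA.
have -> : - iC / 2 * 2%:R * iC = - (iC * iC) by field.
by rewrite iCiC opprK scale1r.
Qed.

Definition rotC (a b : C) : 3.-tuple {mpoly C[3]} :=
  [tuple 'X_0; a *: 'X_1 - b *: 'X_2; b *: 'X_1 + a *: 'X_2].

Definition PhiC n := rotC (toC (cos (2 * pi / n%:R))) (toC (sin (2 * pi / n%:R))).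

Lemma map_Phi n : [tuple map_mpoly toC (tnth (Phi R n) i) | i < 3] = PhiC n.
Proof.
rewrite /Phi /PhiC; set a := cos _; set b := sin _.
apply/eq_from_tnth; apply: ord3P; rewrite [LHS]tnth_mktuple.
- by rewrite [tnth _ 0]/= map_mpolyX.
- by rewrite [tnth _ 1]/= rmorphB /= !map_mpolyZ !map_mpolyX.
by rewrite [tnth _ 2]/= rmorphD /= !map_mpolyZ !map_mpolyX.
Qed.

(** In the coordinates u and v the rotation is diagonal. *)
Lemma comp_to_uv_rotC (a b : C) (F : {mpoly C[3]}) :
  comp_mpoly (rotC a b) F = F ->
  comp_mpoly [tuple vec3 1 (a + iC * b) (a - iC * b) i *: 'X_i | i < 3]
    (comp_mpoly to_uv F) = comp_mpoly to_uv F.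
Proof.
move=> hF.
have eG : comp_mpoly to_uv F =
    comp_mpoly [tuple comp_mpoly to_uv (tnth (rotC a b) i) | i < 3] F.
  by rewrite -comp_mpolyA hF.
rewrite comp_mpolyA eG.
apply: (congr1 (fun q => comp_mpoly q F)).
have col (x y p q : C) : x *: (p *: ('X_1 + 'X_2)) + y *: (q *: ('X_1 - 'X_2)) =
    (x * p + y * q) *: 'X_1 + (x * p - y * q) *: 'X_2 :> {mpoly C[3]}.
  by rewrite -!mul_mpolyC rmorphD rmorphB !rmorphM /=; ring.
have E (x y : C) : - iC / 2 * (x + iC * y) = y * 2^-1 + x * (- iC / 2).
  have H (j : C) : - j / 2 * (x + j * y) = - (j * j) * y * 2^-1 + x * (- j / 2) by ring.
  by rewrite H iCiC opprK mul1r.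
have H (j : C) : a / 2 - b * (- j / 2) = 2^-1 * (a + j * b) by field.
have H' (j : C) : a / 2 + b * (- j / 2) = 2^-1 * (a - j * b) by field.
have t0 : tnth to_uv 0 = 'X_0 by [].
have t1 : tnth to_uv 1 = 2^-1 *: ('X_1 + 'X_2) by [].
have t2 : tnth to_uv 2 = (- iC / 2) *: ('X_1 - 'X_2) by [].
have r0 : tnth (rotC a b) 0 = 'X_0 by [].
have r1 : tnth (rotC a b) 1 = a *: 'X_1 - b *: 'X_2 by [].
have r2 : tnth (rotC a b) 2 = b *: 'X_1 + a *: 'X_2 by [].
apply/eq_from_tnth; apply: ord3P; rewrite [LHS]tnth_mktuple [RHS]tnth_mktuple.
- rewrite t0 r0 !comp_mpolyXi t0.
  by rewrite tnth_mktuple scale1r.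
- rewrite t1 r1 comp_mpolyB !comp_mpolyZ comp_mpolyD !comp_mpolyXi !tnth_mktuple t1 t2.
  rewrite [vec3 _ _ _ 1]/= [vec3 _ _ _ 2]/=.
  rewrite -[- (b *: _)]scaleNr col scalerDr !scalerA.
  by rewrite mulNr opprK (H iC) (H' iC).
rewrite t2 r2 comp_mpolyD !comp_mpolyZ comp_mpolyB !comp_mpolyXi !tnth_mktuple t1 t2.
rewrite [vec3 _ _ _ 1]/= [vec3 _ _ _ 2]/=.
have E2 : - (- iC / 2 * (a - iC * b)) = b * 2^-1 - a * (- iC / 2).
  have e (x y : C) : - (x * (a - y)) = x * (- a + y) by ring.
  by rewrite e (E (- a) b) mulNr.
by rewrite col scalerBr !scalerA (E a b) -scaleNr E2.
Qed.

Section Angle.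
Variable n : nat.
Let th : R := 2 * pi / n%:R.
Let om : C := (cos th +i* sin th)%C.
Let omb : C := (cos th -i* sin th)%C.

Lemma om_omb : om * omb = 1.
Proof.
apply/eqP; rewrite eq_complex /= -(cos2Dsin2 th).
by apply/andP; split; apply/eqP; ring.
Qed.

Lemma to_uv_rotation (F : {mpoly C[3]}) : comp_mpoly (PhiC n) F = F ->
  comp_mpoly [tuple vec3 1 om omb i *: 'X_i | i < 3] (comp_mpoly to_uv F) =
  comp_mpoly to_uv F.
Proof.
move=> hF.
have eo : om = toC (cos th) + iC * toC (sin th) by rewrite [LHS]complexE.
have eob : omb = toC (cos th) - iC * toC (sin th).
  by rewrite [LHS]complexE rmorphN mulrN.
by rewrite eo eob; apply: comp_to_uv_rotC.
Qed.

(** omega^(b - c) = 1 and |b - c| <= n leave only b = c and |b - c| = n. *)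
Lemma rotation_support (F : {mpoly C[3]}) a b c :
  (0 < n)%N -> F \is n.-homog -> comp_mpoly (PhiC n) F = F ->
  (comp_mpoly to_uv F)@_(mnm3 a b c) != 0 ->
  (a + b + c = n)%N /\ (b = c \/ (b, c) = (n, 0%N) \/ (b, c) = (0%N, n)).
Proof.
move=> n0 hom hF; set G := comp_mpoly to_uv F => G0.
have degG : (a + b + c = n)%N.
  have homG : G \is n.-homog.
    apply: dhomog_comp_linear => //; apply: ord3P.
    - by rewrite dhomogX /= mdeg1.
    - by apply: dhomogZ; apply: dhomogD; rewrite dhomogX /= mdeg1.
    by apply: dhomogZ; apply: rpredB; rewrite dhomogX /= mdeg1.
  have := dhomog_mf homG (x := mnm3 a b c); rewrite mcoeff_msupp => /(_ G0).
  by rewrite /= mdeg3 !multinomE.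
split=> //.
have h := diag_invariant_mcoeff (to_uv_rotation hF) G0.
have key k : om ^+ k = 1 -> (k <= n)%N -> k = 0%N \/ k = n.
  move=> e kn; have [->|k0] := posnP k; first by left.
  right; apply/eqP; rewrite eqn_leq kn leqNgt; apply/negP => lt.
  by have := @root_of_unity_order n k; rewrite k0 lt => /(_ isT); rewrite -/th -/om e eqxx.
have ob k : om ^+ k * omb ^+ k = 1 by rewrite -exprMn om_omb expr1n.
have [bc|cb] := leqP c b.
  have := h; rewrite -{1}(subnK bc) exprD -mulrA ob mulr1 => /key[]; first by lia.
  - by move=> ?; left; lia.
  - by move=> ?; right; left; congr (_, _); lia.
have : om ^+ (c - b) = 1.
  have := h; rewrite -{1}(subnK (ltnW cb)) exprD mulrCA ob mulr1 => h'.
  by have := ob (c - b)%N; rewrite h' mulr1.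
case/key; first by lia.
- by lia.
by move=> ?; right; right; congr (_, _); lia.
Qed.
End Angle.

End Rotation.

Section NormalForm.
Variable R : realType.
Local Notation C := R[i].
Local Notation toC := (real_complex R).
Local Notation iC := ('i%C : C).
Local Notation u := (uvar R).
Local Notation v := (vvar R).

Lemma comp_from_uv_monomial a b c :
  comp_mpoly (from_uv R) 'X_[mnm3 a b c] = 'X_0 ^+ a * u ^+ b * v ^+ c.
Proof. by rewrite mpolyX3 !rmorphM !rmorphXn /= !comp_mpolyXi. Qed.

Lemma mnm3_inj a b c a' b' c' :
  mnm3 a b c = mnm3 a' b' c' -> [/\ a = a', b = b' & c = c'].
Proof.
move/mnmP => h; have := h 0; have := h 1; have := h 2.
by rewrite !multinomE /=.
Qed.

Lemma rotation_normal_form n (F : {mpoly C[3]}) :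
  (0 < n)%N -> F \is n.-homog -> comp_mpoly (PhiC R n) F = F ->
  exists (P : {poly C}) (al al' : C), [/\ (size P <= n.+1)%N, has_parity n P &
    F = homogenize (@mpolyC 3 C) 'X_0 (u * v) n P + al *: u ^+ n + al' *: v ^+ n].
Proof.
move=> n0 homF hF; set G := comp_mpoly (to_uv R) F.
pose P := \poly_(i < n.+1) (if odd i == odd n then
  G@_(mnm3 i (n - i)./2 (n - i)./2) else 0).
exists P, G@_(mnm3 0 n 0), G@_(mnm3 0 0 n); split.
- exact: size_poly.
- by move=> i /negbTE hi; rewrite coef_poly hi if_same.
pose s := [seq mnm3 (n - k.*2) k k | k <- iota 0 n./2.+1].
have us : uniq [:: mnm3 0 n 0, mnm3 0 0 n & s].
  rewrite 2!cons_uniq inE negb_or; apply/and3P; split.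
  - apply/andP; split; first by apply/eqP => /mnm3_inj[]; lia.
    by apply/mapP => -[k _ /mnm3_inj[]]; lia.
  - by apply/mapP => -[k _ /mnm3_inj[]]; lia.
  rewrite map_inj_uniq ?iota_uniq // => k l /mnm3_inj[]; lia.
have eG : G = \sum_(m <- [:: mnm3 0 n 0, mnm3 0 0 n & s]) G@_m *: 'X_[m].
  apply: mpoly_sum_supp => // m; rewrite [m]mnm3_eta => ms; apply/eqP.
  move: ms; apply: contraNT => /(rotation_support n0 homF hF)[deg [e|[[e1 e2]|[e1 e2]]]].
  - rewrite 2!in_cons; apply/orP; right; apply/orP; right; apply/mapP.
    exists (m 1%R); first by rewrite mem_iota add0n /=; lia.
    by rewrite -e; congr (mnm3 _ _ _); lia.
  - have e0 : m 0%R = 0%N by lia.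
    by rewrite 2!in_cons e0 e1 e2 eqxx.
  have e0 : m 0%R = 0%N by lia.
  by rewrite 2!in_cons e0 e1 e2 eqxx orbT.
rewrite -[LHS]to_uvK -/G {1}eG 2!big_cons 2!comp_mpolyD 2!comp_mpolyZ 2!comp_from_uv_monomial.
have gen (V : zmodType) (x y z : V) : x + (y + z) = z + x + y.
  by rewrite addrA addrC addrA.
have e1 : 'X_0 ^+ 0 * u ^+ n * v ^+ 0 = u ^+ n by rewrite !expr0 mul1r mulr1.
have e2 : 'X_0 ^+ 0 * u ^+ 0 * v ^+ n = v ^+ n by rewrite !expr0 !mul1r.
rewrite e1 e2 gen.
apply: (congr1 (fun X => X + _ + _)).
rewrite raddf_sum big_map -[iota 0 n./2.+1]/(index_iota 0 n./2.+1) big_mkord; apply: eq_bigr => k _.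
rewrite /= comp_mpolyZ comp_from_uv_monomial coef_poly.
have hk : (k.*2 <= n)%N by rewrite -geq_half_double -ltnS ltn_ord.
rewrite ltnS leq_subr oddB // odd_double addbF eqxx subKn // doubleK.
by rewrite -mul_mpolyC exprMn !mulrA.
Qed.
End NormalForm.

(** * Hyperbolicity on the unit circle *)

Lemma rmorph_normal_form_gen (K T S : comNzRingType) (phi : {rmorphism K -> T})
    (g : {rmorphism T -> S}) (t w1 w2 a b : T) n p :
  g (homogenize phi t (w1 * w2) n p + a * w1 ^+ n + b * w2 ^+ n) =
  homogenize (g \o phi) (g t) (g w1 * g w2) n p + g a * g w1 ^+ n + g b * g w2 ^+ n.
Proof. by rewrite !rmorphD rmorph_homogenize !rmorphM !rmorphXn. Qed.

Section Sections.
Variable R : realType.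
Local Notation C := R[i].
Local Notation toC := (real_complex R).
Local Notation iC := ('i%C : C).
Local Notation u := (uvar R).
Local Notation v := (vvar R).

(** The shape that [rotation_normal_form] gives to every form of degree n invariant
    under the rotation by 2 pi / n. *)
Definition normal_form n (P : {poly C}) (al al' : C) : {mpoly C[3]} :=
  homogenize (@mpolyC 3 C) 'X_0 (u * v) n P + al *: u ^+ n + al' *: v ^+ n.

Lemma rmorph_normal_form (S : comNzRingType) (g : {rmorphism {mpoly C[3]} -> S}) n P al al' :
  g (normal_form n P al al') =
  homogenize (g \o @mpolyC 3 C) (g 'X_0) (g u * g v) n P +
    g al%:MP * g u ^+ n + g al'%:MP * g v ^+ n.
Proof.
by rewrite /normal_form -!mul_mpolyC; apply: rmorph_normal_form_gen.
Qed.

Lemma meval_uvar (z : 'I_3 -> C) : u.@[z] = z 1 + iC * z 2.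
Proof. by rewrite /uvar mevalD mevalZ !mevalXU. Qed.

Lemma meval_vvar (z : 'I_3 -> C) : v.@[z] = z 1 - iC * z 2.
Proof. by rewrite /vvar mevalB mevalZ !mevalXU. Qed.

Lemma homogenize00 (K T : comNzRingType) (phi : {rmorphism K -> T}) n p :
  (0 < n)%N -> homogenize phi 0 0 n p = 0.
Proof.
move=> n0; rewrite /homogenize big1 // => -[[|k] hk] _ /=.
  by rewrite subn0 expr0n; case: n n0 {hk} => //= n _; rewrite mulr0 mul0r.
by rewrite exprS mul0r mulr0.
Qed.

Lemma homogenize_t1w0 (K T : comNzRingType) (phi : {rmorphism K -> T}) n p :
  homogenize phi 1 0 n p = phi p`_n.
Proof.
rewrite /homogenize big_ord_recl big1 => [|k _].
  by rewrite addr0 subn0 expr1n !mulr1.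
by rewrite exprS mul0r mulr0.
Qed.

(** The two points are those with t = 0 and (u, v) = (1, 0), resp. (0, 1). *)
Lemma normal_form_alpha n P al al' : (0 < n)%N ->
  (normal_form n P al al').@[vec3 0 2^-1 (- iC / 2)] = al /\
  (normal_form n P al al').@[vec3 0 2^-1 (iC / 2)] = al'.
Proof.
move=> n0; rewrite !rmorph_normal_form /= !mevalXU !meval_uvar !meval_vvar !mevalC.
rewrite ![vec3 _ _ _ 0]/= ![vec3 _ _ _ 1]/= ![vec3 _ _ _ 2]/=.
have e1 : 2^-1 + iC * (- iC / 2) = 1.
  have h (j : C) : 2^-1 + j * (- j / 2) = 2^-1 - (j * j) / 2 by ring.
  by rewrite h iCiC; field.
have e2 : 2^-1 - iC * (- iC / 2) = 0.
  have h (j : C) : 2^-1 - j * (- j / 2) = 2^-1 + (j * j) / 2 by ring.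
  by rewrite h iCiC; field.
have e3 : 2^-1 + iC * (iC / 2) = 0.
  by rewrite mulrA iCiC mulN1r subrr.
have e4 : 2^-1 - iC * (iC / 2) = 1.
  by rewrite mulrA iCiC mulN1r opprK; field.
rewrite e1 e2 e3 e4 mulr0 mul0r expr1n expr0n (gtn_eqF n0) /= !homogenize00 //.
by rewrite !mulr0 !mulr1 !add0r !addr0.
Qed.

Lemma normal_form_t n P al al' : (0 < n)%N ->
  (normal_form n P al al').@[vec3 1 0 0] = P`_n.
Proof.
move=> n0; rewrite !rmorph_normal_form /= !mevalXU !meval_uvar !meval_vvar !mevalC.
rewrite ![vec3 _ _ _ 0]/= ![vec3 _ _ _ 1]/= ![vec3 _ _ _ 2]/=.
rewrite mulr0 subrr addr0 mulr0 homogenize_t1w0 expr0n (gtn_eqF n0) /=.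
by rewrite !mulr0 !addr0 mevalC.
Qed.

Lemma conj_meval (f : {mpoly R[3]}) (z : 'I_3 -> C) :
  ((map_mpoly toC f).@[z])^* = (map_mpoly toC f).@[fun i => (z i)^*].
Proof.
apply: (rmorph_mpoly_eq (f := Num.conj \o meval z \o map_mpoly toC)
   (g := meval (fun i => (z i)^*) \o map_mpoly toC)) => [c|i] /=.
  by rewrite map_mpolyC !mevalC; apply/CrealP/complex_realP; eexists.
by rewrite map_mpolyX !mevalXU.
Qed.

(** Kept over the reals, so that its equality with P + constant on the unit circle
    also shows that P has real coefficients. *)
Definition section_poly (f : {mpoly R[3]}) (x y : R) : {poly R} :=
  mmap polyC (vec3 'X x%:P y%:P) f.

Lemma section_polyE f x y (z : C) :
  (map_poly toC (section_poly f x y)).[z] =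
  (map_mpoly toC f).@[vec3 z (toC x) (toC y)].
Proof.
apply: (rmorph_mpoly_eq
   (f := horner_eval z \o map_poly toC \o mmap polyC (vec3 'X x%:P y%:P))
   (g := meval (vec3 z (toC x) (toC y)) \o map_mpoly toC)) => [c|i] /=.
  by rewrite mmapC map_mpolyC mevalC map_polyC /horner_eval hornerC.
rewrite map_mpolyX mevalXU mmapX mmap1U /horner_eval.
move: i; apply: ord3P; rewrite /vec3 /=.
- by rewrite map_polyX hornerX.
- by rewrite map_polyC hornerC.
by rewrite map_polyC hornerC.
Qed.

Lemma line_polyE (f : {mpoly R[3]}) (e z : 'I_3 -> R) (l : C) :
  (map_poly toC (line_poly f e z)).[l] =
  (map_mpoly toC f).@[fun i => toC (e i) + toC (z i) * l].
Proof.
apply: (rmorph_mpoly_eq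
   (f := horner_eval l \o map_poly toC \o mmap polyC (fun i => (e i)%:P + z i *: 'X))
   (g := meval (fun i => toC (e i) + toC (z i) * l) \o map_mpoly toC)) => [c|i] /=.
  by rewrite mmapC map_mpolyC mevalC map_polyC /horner_eval hornerC.
rewrite map_mpolyX mevalXU mmapX mmap1U /horner_eval rmorphD /= map_polyC.
by rewrite map_polyZ /= map_polyX !hornerE.
Qed.

(** Hyperbolicity is stated for the lines e + lambda z; by homogeneity a root tau of
    f(tau, x, y), tau nonzero, gives the root 1/tau of f(1, lambda x, lambda y). *)
Lemma section_real_rooted n f x y : f \is n.-homog -> hyperbolic f (vec3 1 0 0) ->
  real_rooted (section_poly f x y).
Proof.
move=> hom [_ hyp] z; rewrite /root section_polyE => /eqP Fz.
have [->|z0] := eqVneq z 0; first exact: real0.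
suff : z^-1 \is Num.real by rewrite realV.
apply: (hyp (vec3 0 x y)); rewrite /root line_polyE.
have homF : map_mpoly toC f \is n.-homog by apply: dhomog_map_mpoly.
rewrite (dhomog_meval (c := z^-1) (v := vec3 z (toC x) (toC y)) homF).
  by rewrite Fz mulr0.
have e0 : toC 1 + toC 0 * z^-1 = z^-1 * z by rewrite rmorph0 mul0r addr0 rmorph1 mulVf.
have e1 (r : R) : toC 0 + toC r * z^-1 = z^-1 * toC r by rewrite rmorph0 add0r mulrC.
by apply: ord3P; [exact: e0 | exact: e1 | exact: e1].
Qed.

Lemma section_normal_form n f P al al' x y :
  has_parity n P -> (size P <= n.+1)%N -> x ^+ 2 + y ^+ 2 = 1 ->
  map_mpoly toC f = normal_form n P al al' ->
  map_poly toC (section_poly f x y) =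
  P + (al * (toC x + iC * toC y) ^+ n + al' * (toC x - iC * toC y) ^+ n)%:P.
Proof.
move=> pP sP xy ef.
pose psi : {rmorphism {mpoly C[3]} -> {poly C}} :=
  mmap (@polyC C) (vec3 'X (toC x)%:P (toC y)%:P).
have -> : map_poly toC (section_poly f x y) = psi (map_mpoly toC f).
  apply: (rmorph_mpoly_eq (f := map_poly toC \o mmap polyC (vec3 'X x%:P y%:P))
    (g := psi \o map_mpoly toC)) => [c|i] /=.
    by rewrite mmapC map_mpolyC /psi mmapC map_polyC.
  rewrite map_mpolyX /psi !mmapX !mmap1U.
  move: i; apply: ord3P; rewrite /vec3 /=.
  - by rewrite map_polyX.
  - by rewrite map_polyC.
  by rewrite map_polyC.
have pX i : psi 'X_i = vec3 'X (toC x)%:P (toC y)%:P i by rewrite /psi /= mmapX mmap1U.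
have pC c : psi c%:MP = c%:P by rewrite /psi /= mmapC.
have pu : psi u = (toC x + iC * toC y)%:P.
  by rewrite /uvar -mul_mpolyC (rmorphD psi) (rmorphM psi) !pX pC rmorphD rmorphM.
have pv : psi v = (toC x - iC * toC y)%:P.
  by rewrite /vvar -mul_mpolyC (rmorphB psi) (rmorphM psi) !pX pC rmorphB rmorphM.
rewrite ef (rmorph_normal_form psi) pu pv pX !pC -rmorphM.
have -> : (toC x + iC * toC y) * (toC x - iC * toC y) = 1.
  have h (j a b : C) : (a + j * b) * (a - j * b) = a ^+ 2 - (j * j) * b ^+ 2 by ring.
  by rewrite h iCiC mulN1r opprK -!rmorphXn -rmorphD xy rmorph1.
move: (toC x + _) (toC x - _) => w1 w2.
rewrite polyCD !polyCM !polyC_exp addrA; congr (_ + _ + _).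
rewrite -[RHS](homogenize_w1 pP sP); apply: eq_bigr => k _.
by rewrite /= pC.
Qed.
End Sections.

(** * From weights to determinantal representations *)

(** With j = i and h = 1/2 this rewrites x Re(A) + y Im(A) entrywise as
    (v A + u A^* )/2. *)
Lemma half_combination (A : comNzRingType) (j h p q : A) (X Y : {mpoly A[3]}) :
  X * (h * (p + q))%:MP + Y * ((- j * h) * (p - q))%:MP =
  p%:MP * (h *: (X - j *: Y)) + q%:MP * (h *: (X + j *: Y)).
Proof.
rewrite -!mul_mpolyC !(rmorphM (@mpolyC 3 A)) !(rmorphD (@mpolyC 3 A)).
by rewrite !(rmorphN (@mpolyC 3 A)) /=; ring.
Qed.

Lemma scaled_product (A : comNzRingType) (p q h : A) (X Y : {mpoly A[3]}) :
  (p%:MP * (h *: X)) * (q%:MP * (h *: Y)) = (p * q * h ^+ 2)%:MP * (Y * X).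
Proof.
by rewrite -!mul_mpolyC !(rmorphM (@mpolyC 3 A)) /=; ring.
Qed.

Lemma scaled_prod (A : comNzRingType) n (p : 'I_n -> A) (h : A) (X : {mpoly A[3]}) :
  \prod_i ((p i)%:MP * (h *: X)) = (\prod_i p i * h ^+ n) *: X ^+ n.
Proof.
rewrite big_split /= -rmorph_prod prodr_const card_ord exprZn -mul_mpolyC.
by rewrite -[RHS]mul_mpolyC (rmorphM (@mpolyC 3 A)) /= mulrA.
Qed.

Lemma sign_cancel (A : comNzRingType) k (x y : A) (X Y : {mpoly A[3]}) :
  (-1) ^+ k * (((-1) ^+ k * x) *: X + ((-1) ^+ k * y) *: Y) = y *: Y + x *: X.
Proof.
rewrite -!mul_mpolyC !(rmorphM (@mpolyC 3 A)) !(rmorphXn (@mpolyC 3 A)).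
rewrite rmorphN rmorph1 -!mulrA -mulrDr mulrA -expr2 sqrr_sign mul1r addrC.
by [].
Qed.

Lemma homogenize_cyclic (K T : comNzRingType) (phi : {rmorphism K -> T}) (t w : T) m
    (Q N L : {poly K}) q k l p0 pl :
  q = homogenize phi t w m.+1 Q -> w * k = homogenize phi t w m.+2 N ->
  l = homogenize phi t w m L -> (size L <= m.+1)%N ->
  homogenize phi t w m.+2 ('X * Q - p0 *: N - pl *: L) =
  t * q - phi p0 * w * k - phi pl * w * l.
Proof.
move=> -> e -> sL.
rewrite !homogenizeB homogenize_mulX !homogenizeZ -e.
rewrite -(homogenize_mulw phi t w (n := m) (p := L)); last by apply: leqW.
by rewrite !mulrA.
Qed.

Lemma conj_signed (C : numClosedFieldType) k l (x : C) :
  ((-1) ^+ k * 2 ^+ l * x^*)^* = (-1) ^+ k * 2 ^+ l * x.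
Proof. by rewrite !rmorphM !rmorphXn /= conjCK rmorphN rmorph1 rmorph_nat. Qed.

Lemma cancel_pow2 (C : numFieldType) k l (x : C) :
  (-1) ^+ k * 2 ^+ l * x * 2^-1 ^+ l = (-1) ^+ k * x.
Proof. by rewrite exprVn mulrAC mulfK // expf_neq0 // pnatr_eq0. Qed.

Section Assembly.
Variable R : realType.
Local Notation C := R[i].
Local Notation toC := (real_complex R).
Local Notation iC := ('i%C : C).
Local Notation u := (uvar R).
Local Notation v := (vvar R).

(** Superdiagonal entries of (v A + u A^* )/2 for a cyclic shift A. *)
Definition upper n (a : 'I_n -> C) (i : 'I_n) : {mpoly C[3]} := (a i)%:MP * (2^-1 *: v).
Definition lower n (a : 'I_n -> C) (i : 'I_n) : {mpoly C[3]} := ((a i)^*)%:MP * (2^-1 *: u).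

Lemma inv2i : (2 * iC)^-1 = - iC * 2^-1.
Proof.
have j0 : iC != 0 by rewrite eq_complex /= oner_eq0 andbF.
apply: (mulfI (x := 2 * iC)); first by rewrite mulf_neq0 // pnatr_eq0.
rewrite divff ?mulf_neq0 ?pnatr_eq0 //.
have h (j : C) : 2 * j * (- j * 2^-1) = - (j * j) by field.
by rewrite h iCiC opprK.
Qed.

Lemma det_poly_cyclic n (a : 'I_n -> C) :
  det_poly (cyclic_shift a) = \det (cyclic_tridiag 'X_0 (upper a) (lower a)).
Proof.
have key (p q : C) : 'X_1 * (2^-1 * (p + q))%:MP + 'X_2 * ((2 * iC)^-1 * (p - q))%:MP =
    p%:MP * (2^-1 *: v) + q%:MP * (2^-1 *: u).
  by rewrite inv2i; apply: half_combination.
have eRe (M : 'M[C]_n) i j : mxRe M i j = 2^-1 * (M i j + (M j i)^*).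
  by rewrite /mxRe mxE; congr (_ * _); rewrite mxE; congr (_ + _); rewrite mxE mxE.
have eIm (M : 'M[C]_n) i j : mxIm M i j = (2 * iC)^-1 * (M i j - (M j i)^*).
  rewrite /mxIm mxE; congr (_ * _); rewrite mxE; congr (_ + _); rewrite mxE.
  by congr (- _); rewrite mxE mxE.
have addE (M N : 'M[{mpoly C[3]}]_n) i j : (M + N) i j = M i j + N i j by rewrite mxE.
have mulE (c : {mpoly C[3]}) (M : 'M[C]_n) i j :
    (c *: map_mx (@mpolyC 3 C) M) i j = c * (M i j)%:MP by rewrite mxE mxE.
rewrite /det_poly /cyclic_tridiag; apply: (congr1 determinant); apply/matrixP => i j.
apply: etrans (addE _ _ _ _) _.
apply: etrans (congr2 +%R (addE _ _ _ _) (mulE _ _ _ _)) _.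
apply: etrans (congr2 +%R (congr2 +%R (erefl _) (mulE _ _ _ _)) (erefl _)) _.
rewrite eRe eIm.
rewrite -addrA.
rewrite key.
rewrite 2!addE -addrA.
apply: (congr1 (fun X => _ + X)); apply: (congr2 +%R).
  by rewrite 2!mxE; case: eqP => _; rewrite ?mul0r.
by rewrite [_^T _ _]mxE 2!mxE; case: eqP => _; rewrite ?rmorph0 ?mul0r.
Qed.

Lemma chain_lead (ps : seq R) :
  let AB := chain 'X ('X, (1 : {poly R})) (map polyC ps) in
  [/\ AB.1`_(size ps).+1 = 1, (size AB.1 <= (size ps).+2)%N & (size AB.2 <= (size ps).+1)%N].
Proof.
elim: ps => [|p ps [IH1 IH2 IH3]] /=; first by rewrite coefX size_polyX size_poly1.
split=> //.
  by rewrite coefB coefXM coefCM /= IH1 nth_default ?mulr0 ?subr0 // leqW.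
apply: leq_trans (size_polyD _ _) _; rewrite geq_max size_polyN mul_polyC.
rewrite (leq_trans (size_scale_leq _ _)) ?andbT; last by apply: leq_trans IH3 _; rewrite leqW.
by rewrite mulrC; apply: leq_trans (size_polyMleq _ _) _; rewrite size_polyX addn2.
Qed.

(** The moduli of the a_i match the weights and the product of the a_i matches the
    coefficient of v^n; no other datum of the a_i enters the determinant. *)
Lemma det_of_weights m (P : {poly R}) p0 pl (ps : seq R) (al : C) (a : nat -> C) :
  size ps = m ->
  (let QK := chain 'X ('X, 1) (map polyC ps) in
   let L := (chain 'X (1, 0) (map polyC ps)).1 in
   P = 'X * QK.1 - p0 *: QK.2 - pl *: L) ->
  (forall i, (i < m.+2)%N -> a i * (a i)^* = toC (4 * (p0 :: rcons ps pl)`_i)) ->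
  \prod_(i < m.+2) a i = (-1) ^+ m.+1 * 2 ^+ m.+2 * al^* ->
  normal_form m.+2 (map_poly toC P) al al^* = det_poly (cyclic_shift (fun i : 'I_m.+2 => a i)).
Proof.
move=> sps eP ha pa; rewrite det_poly_cyclic.
pose phi : {rmorphism R -> {mpoly C[3]}} := @mpolyC 3 C \o toC.
pose t : {mpoly C[3]} := 'X_0; pose w := u * v.
pose A i := (a i)%:MP * (2^-1 *: v) : {mpoly C[3]}.
pose B i := ((a i)^*)%:MP * (2^-1 *: u) : {mpoly C[3]}.
have AB i : (i < m.+2)%N -> A i * B i = phi (p0 :: rcons ps pl)`_i * w.
  move=> hi; rewrite scaled_product ha //; congr (_%:MP * _).
  have h4 (x : C) : 4 * x * 2^-1 ^+ 2 = x by field.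
  by rewrite rmorphM rmorph_nat h4.
have ews : mkseq (fun i => A i.+1 * B i.+1) m = [seq phi p * w | p <- ps].
  apply: (@eq_from_nth _ 0); first by rewrite size_mkseq size_map sps.
  move=> i; rewrite size_mkseq => im; rewrite nth_mkseq // AB; last by rewrite !ltnS ltnW.
  by rewrite (nth_map 0) ?sps //= nth_rcons sps im.
have h1 : t = homogenize phi t w 1 'X.
  by rewrite /homogenize big_ord1 coefX subn0 rmorph1 mul1r expr1 mulr1.
have h2 : w * 1 = homogenize phi t w 2 1.
  rewrite /homogenize !big_ord_recl big_ord0 !coefC /= rmorph0 rmorph1.
  by rewrite !mul0r add0r addr0 expr0 !mul1r expr1 mulr1.
have h3 : 1 = homogenize phi t w 0 1.
  by rewrite /homogenize big_ord1 coefC /= rmorph1 !expr0 !mulr1.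
have h4 : w * 0 = homogenize phi t w 1 0.
  by rewrite /homogenize big_ord1 coefC /= rmorph0 !mul0r mulr0.
have [||e1 e2 s1 s2] := homogenize_chain ps h1 h2; rewrite ?size_polyX ?size_poly1 //.
have [||e3 _ s3 _] := homogenize_chain ps h3 h4; rewrite ?size_poly1 ?size_poly0 //.
rewrite addn0 sps in e3 s3; rewrite addn1 sps in e1 e2 s1 s2.
have [lead _ _] := chain_lead ps; rewrite sps in lead.
set QK := chain 'X _ _ in e1 e2 s1 s2 eP lead; set L := (chain 'X (1, 0) _).1 in e3 s3 eP.
set qk := chain t (t, 1) _ in e1 e2; set l := (chain t (1, 0) _).1 in e3.
have qk0 : qk.1 != 0.
  apply/eqP => /(congr1 (meval (vec3 1 0 0))); rewrite e1 rmorph_homogenize meval0.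
  rewrite /= /t /w mevalXU mevalM meval_uvar meval_vvar.
  rewrite ![vec3 _ _ _ 0]/= ![vec3 _ _ _ 1]/= ![vec3 _ _ _ 2]/=.
  rewrite mulr0 addr0 mul0r homogenize_t1w0 lead rmorph1.
  by move/eqP; rewrite oner_eq0.
have eD : \det (cyclic_tridiag t (fun i : 'I_m.+2 => A i) (fun i => B i)) =
    t * qk.1 - phi p0 * w * qk.2 - phi pl * w * l +
    (-1) ^+ m.+1 * (\prod_(i < m.+2) A i + \prod_(i < m.+2) B i).
  have a0 : A 0%N * B 0%N = phi p0 * w := AB 0%N isT.
  have al' : A m.+1 * B m.+1 = phi pl * w.
    have hl : (p0 :: rcons ps pl)`_m.+1 = pl by rewrite /= nth_rcons sps ltnn eqxx.
    by rewrite AB // hl.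
  exact: (@det_cyclic_tridiag {mpoly C[3]} t _ _ m A B _ ews a0 al' qk0).
apply: etrans (esym eD).
have eN : normal_form m.+2 (map_poly toC P) al al^* =
    homogenize phi t w m.+2 P + al *: u ^+ m.+2 + al^* *: v ^+ m.+2.
  apply: (congr1 (fun X => X + _ + _)).
  by apply: eq_bigr => k _; rewrite coef_map.
rewrite eN.
have -> : homogenize phi t w m.+2 P = t * qk.1 - phi p0 * w * qk.2 - phi pl * w * l.
  by apply: etrans (congr1 _ eP) _; apply: (homogenize_cyclic p0 pl e1 e2 e3 s3).
rewrite -addrA; apply: (congr1 (fun X => _ + X)).
have pb : \prod_(i < m.+2) (a i)^* = (-1) ^+ m.+1 * 2 ^+ m.+2 * al.
  by apply: etrans (conj_signed _ _ _); rewrite -pa rmorph_prod.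
have simp (x : C) : (-1) ^+ m.+1 * 2 ^+ m.+2 * x * 2^-1 ^+ m.+2 = (-1) ^+ m.+1 * x.
  exact: cancel_pow2.
have -> : \prod_(i < m.+2) A i = ((-1) ^+ m.+1 * al^*) *: v ^+ m.+2.
  by apply: etrans (scaled_prod _ _ _) _; rewrite pa simp.
have -> : \prod_(i < m.+2) B i = ((-1) ^+ m.+1 * al) *: u ^+ m.+2.
  by apply: etrans (scaled_prod _ _ _) _; rewrite pb simp.
by rewrite sign_cancel.
Qed.
End Assembly.

(** * Phases and the invariant data of a hyperbolic polynomial *)

(** Choose w as an n-th root of ze conj(al) / |al|, so that al w^n = |al| ze. *)
Lemma unit_phase_root (C : numClosedFieldType) n (al ze : C) : (0 < n)%N -> al != 0 ->
  `|ze| = 1 ->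
  exists w, `|w| = 1 /\ al * w ^+ n + al^* * w^* ^+ n = `|al| * (ze + ze^*).
Proof.
move=> n0 al0 z1; pose x := ze * al^* / `|al|.
have na : `|al| != 0 by rewrite normr_eq0.
have x1 : `|x| = 1.
  by rewrite /x normrM normrM normfV normr_id norm_conjC z1 mul1r divff.
exists (n.-root x); split; first by rewrite norm_rootC x1 rootC1.
have e : al * (n.-root x) ^+ n = `|al| * ze.
  by rewrite rootCK // /x mulrA mulrCA -normCK; field.
have -> : al^* * (n.-root x)^* ^+ n = (al * (n.-root x) ^+ n)^*.
  by rewrite rmorphM rmorphXn.
rewrite e rmorphM mulrDr; congr (_ + _ * _).
by apply/CrealP; apply: normr_real.
Qed.

Lemma conj_opp_half (C : numClosedFieldType) (x y : C) :
  x^* = - y -> (- x / 2)^* = y / 2.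
Proof. by move=> e; rewrite rmorphM rmorphN /= e opprK fmorphV rmorph_nat. Qed.

Lemma mul_conj_phase (C : numClosedFieldType) (x p : C) :
  x^* = x -> p * p^* = 1 -> x * p * (x * p)^* = x * x.
Proof. by move=> xr p1; rewrite rmorphM /= xr mulrACA p1 mulr1. Qed.

Section Final.
Variable R : realType.
Local Notation C := R[i].
Local Notation toC := (real_complex R).
Local Notation iC := ('i%C : C).
Local Notation u := (uvar R).
Local Notation v := (vvar R).

Lemma toC_conj (r : R) : (toC r)^* = toC r.
Proof. by apply/CrealP/complex_realP; eexists. Qed.

Lemma norm_iC : `|iC| = 1.
Proof. by rewrite normc_def /= expr0n expr1n add0r sqrtr1. Qed.

Lemma conj_iC : iC^* = - iC.
Proof. by apply/eqP; rewrite eq_complex /= oppr0 !eqxx. Qed.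

Lemma conj_half : (2^-1 : C)^* = 2^-1.
Proof. by rewrite fmorphV rmorph_nat. Qed.

Lemma conj_half_iC : (- iC / 2)^* = iC / 2.
Proof. exact: conj_opp_half conj_iC. Qed.

Lemma real_imag_unit (w : C) : `|w| = 1 ->
  [/\ complex.Re w ^+ 2 + complex.Im w ^+ 2 = 1,
      toC (complex.Re w) + iC * toC (complex.Im w) = w &
      toC (complex.Re w) - iC * toC (complex.Im w) = w^*].
Proof.
move=> w1; have e : toC (complex.Re w) + iC * toC (complex.Im w) = w by rewrite -complexE.
split=> //; first by apply: (@complexI R); rewrite /= add_Re2_Im2 w1 expr1n.
by rewrite -[in RHS]e rmorphD rmorphM /= !toC_conj conj_iC mulNr.
Qed.

(** The phases i, 1 and -1 of al w^n give the values 0, 2b and - 2b. *)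
Lemma attained_values n (al : C) (b c : R) : (0 < n)%N -> toC b = `|al| ->
  c \in [:: 0; 2 * b; - (2 * b)] ->
  exists x y : R, x ^+ 2 + y ^+ 2 = 1 /\
    al * (toC x + iC * toC y) ^+ n + al^* * (toC x - iC * toC y) ^+ n = toC c.
Proof.
move=> n0 eb hc.
have [a0|a0] := eqVneq al 0.
  have b0 : b = 0 by apply: (@complexI R); rewrite eb a0 normr0 rmorph0.
  exists 1, 0; split; first by rewrite expr1n expr0n addr0.
  rewrite a0 conjC0 !mul0r addr0; move: hc; rewrite b0 mulr0 oppr0 !inE !orbb.
  by move/eqP=> ->; rewrite rmorph0.
have [ze [z1 ez]] : exists ze : C, `|ze| = 1 /\ `|al| * (ze + ze^*) = toC c.
  rewrite -eb; move: hc; rewrite !inE => /or3P[] /eqP ->.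
  - by exists iC; rewrite norm_iC conj_iC subrr mulr0 rmorph0.
  - by exists 1; rewrite normr1 conjC1 mulrC rmorphM rmorphD rmorph1.
  exists (-1); have -> : (-1)^* = -1 :> C by rewrite rmorphN rmorph1.
  by rewrite normrN1 -opprD mulrN mulrC rmorphN rmorphM rmorphD rmorph1.
have [w [w1 ew]] := unit_phase_root n0 a0 z1.
have [e1 e2 e3] := real_imag_unit w1.
by exists (complex.Re w), (complex.Im w); rewrite e1 e2 e3 ew ez.
Qed.

(** What remains of an invariant hyperbolic f: the polynomial P, the coefficient al
    of u^n with its modulus b, and the real-rootedness of P + c at the centre and
    the ends of the interval [-2b, 2b]. *)
Definition invariant_data n (f : {mpoly R[3]}) (P : {poly R}) (al : C) (b : R) :=
  [/\ map_mpoly toC f = normal_form n (map_poly toC P) al al^*, size P = n.+1,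
    P \is monic, has_parity n P &
    [/\ 0 <= b, toC b = `|al| &
    forall c, c \in [:: 0; 2 * b; - (2 * b)] -> real_rooted (P + c%:P)]].

Lemma cyclic_invariant_data n (f : {mpoly R[3]}) : (0 < n)%N -> f \is n.-homog ->
  hyperbolic f (vec3 1 0 0) -> f.@[vec3 1 0 0] = 1 -> cyclic_invariant n f ->
  exists P al b, invariant_data n f P al b.
Proof.
move=> n0 hom hyp f1 inv; set F := map_mpoly toC f.
have homF : F \is n.-homog by apply: dhomog_map_mpoly.
have invF : comp_mpoly (PhiC R n) F = F.
  by rewrite -map_Phi -[F in LHS]/(map_mpoly toC f) -map_comp_mpoly inv.
have [PC [al [al' [sPC pPC eF]]]] := rotation_normal_form n0 homF invF.
rewrite -/(normal_form n PC al al') in eF.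
have [ea ea'] := normal_form_alpha PC al al' n0.
have eal : al' = al^*.
  rewrite -eF in ea; rewrite -eF in ea'; rewrite -ea -ea' /F conj_meval; apply: meval_eq; apply: ord3P.
  - exact: esym (conjC0 _).
  - exact: esym conj_half.
  exact: esym conj_half_iC.
rewrite eal in eF.
have [b eb] : exists b, `|al| = toC b by apply/complex_realP; apply: normr_real.
pose P := section_poly f 1 0 - (2 * complex.Re al)%:P.
have ePC : PC = map_poly toC P.
  have h := section_normal_form (x := 1) (y := 0) pPC sPC _ eF.
  rewrite rmorphB /= h; last by rewrite expr1n expr0n addr0.
  rewrite map_polyC rmorph1 rmorph0 mulr0 subr0 addr0 expr1n !mulr1.
  suff -> : al + al^* = toC (2 * complex.Re al) by rewrite addrK.
  by rewrite rmorphM rmorph_nat; apply: addcJ.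
have sP : size P = size PC by rewrite ePC size_map_poly.
have PCn : PC`_n = 1.
  rewrite -(normal_form_t PC al al^* n0) -eF.
  have -> : F.@[vec3 1 0 0] = toC (f.@[vec3 1 0 0]).
    apply: (rmorph_mpoly_eq (f := meval (vec3 1 0 0) \o map_mpoly toC)
      (g := toC \o meval (vec3 1 0 0))) => [c|i] /=.
      by rewrite map_mpolyC !mevalC.
    rewrite map_mpolyX !mevalXU.
    by move: i; apply: ord3P.
  by rewrite f1 rmorph1.
have sn : size P = n.+1.
  apply/eqP; rewrite eqn_leq sP sPC ltnNge; apply/negP => h.
  have := nth_default 0 h; rewrite PCn => /eqP; rewrite oner_eq0.
  by [].
have coefP i : PC`_i = toC P`_i by rewrite ePC coef_map.
exists P, al, b; split.
- by rewrite -ePC.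
- exact: sn.
- apply/eqP; apply: (@complexI R); rewrite lead_coefE sn -coefP PCn.
  by rewrite rmorph1.
- by move=> i hi; apply: (@complexI R); rewrite -coefP pPC // rmorph0.
split; first by rewrite -ler0c -[b%:C%C]eb normr_ge0.
  exact: esym eb.
move=> c hc; have [x [y [xy ev]]] := attained_values n0 (esym eb) hc.
have -> : P + c%:P = section_poly f x y.
  apply: (map_poly_inj toC); rewrite rmorphD /= map_polyC -ePC.
  by rewrite (section_normal_form pPC sPC xy eF) ev.
exact: section_real_rooted hom hyp.
Qed.

(** The reflection exchanges u and v, hence the coefficients al and conj(al). *)
Lemma dihedral_alpha_real n (f : {mpoly R[3]}) P al b : (0 < n)%N ->
  invariant_data n f P al b -> comp_mpoly (Gamma R) f = f ->
  exists r, al = toC r.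
Proof.
move=> n0 [eF _ _ _ _] inv; apply/complex_realP; apply/CrealP.
have [ea ea'] := normal_form_alpha (map_poly toC P) al al^* n0.
rewrite -eF in ea; rewrite -eF in ea'.
rewrite -ea' -[RHS]ea -[in LHS]inv map_comp_mpoly comp_mpoly_meval.
apply: meval_eq; apply: ord3P; rewrite tnth_mktuple /=.
- by rewrite [tnth _ _]/= map_mpolyX mevalXU.
- by rewrite [tnth _ _]/= map_mpolyX mevalXU.
rewrite [tnth _ _]/= rmorphN /= map_mpolyX mevalN mevalXU.
by rewrite /vec3 /= mulNr.
Qed.

Lemma prod_sqrt_weights m (p0 pl b : R) (ps : seq R) : size ps = m -> 0 <= b ->
  all (fun w => 0 <= w) [:: p0, pl & ps] -> p0 * pl * \prod_(w <- ps) w = b ^+ 2 ->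
  \prod_(i < m.+2) Num.sqrt (p0 :: rcons ps pl)`_i = b.
Proof.
move=> sps b0 /and3P[h0 hl hps'] pb.
have hps : all (fun w => 0 <= w) ps := hps'.
apply/eqP; rewrite -(eqrXn2 (n := 2)) ?prodr_ge0 // => [|i _]; last exact: sqrtr_ge0.
rewrite -prodrXl -pb; apply/eqP.
rewrite (eq_bigr (fun i : 'I_m.+2 => (p0 :: rcons ps pl)`_i)) => [|i _].
  have sl : size (p0 :: rcons ps pl) = m.+2 by rewrite /= size_rcons sps.
  rewrite -sl -(big_mkord xpredT (fun i => (p0 :: rcons ps pl)`_i)) -(big_nth 0 xpredT id).
  by rewrite big_cons -cats1 big_cat big_seq1 /=; ring.
rewrite sqr_sqrtr //; have : all (fun w => 0 <= w) (p0 :: rcons ps pl).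
  by rewrite /= h0 all_rcons hl hps.
by move/all_nthP; apply; rewrite /= size_rcons sps.
Qed.

(** The phase ph is placed on the last entry of the shift only. *)
Lemma weights_to_matrix m f P al b (ph : C) : invariant_data m.+2 f P al b ->
  ph * ph^* = 1 -> toC b * ph = (-1) ^+ m.+1 * al^* ->
  exists s : nat -> R, map_mpoly toC f = det_poly (cyclic_shift
    (fun i : 'I_m.+2 => toC (s i) * (if i == m.+1 :> nat then ph else 1))).
Proof.
move=> [-> sP mP pP [b0 _ rr]] ph1 eph.
have [p0 [pl [ps [sps hge pb eP]]]] := cyclic_weights_exist b0 sP mP pP rr.
pose l := p0 :: rcons ps pl.
exists (fun i => 2 * Num.sqrt l`_i).
apply: (@det_of_weights R m P p0 pl ps al
  (fun i => toC (2 * Num.sqrt l`_i) * (if i == m.+1 then ph else 1)) sps eP) => [i hi|].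
  have ph' : (if i == m.+1 then ph else 1) * (if i == m.+1 then ph else 1)^* = 1.
    by case: ifP => _; [exact: ph1 | rewrite conjC1 mulr1].
  apply: etrans (mul_conj_phase (toC_conj _) ph') _.
  apply: etrans (esym (rmorphM toC _ _)) _; apply: congr1.
  have hl : 0 <= l`_i.
    have : all (fun w => 0 <= w) l by move: hge; rewrite /= all_rcons.
    by move/all_nthP; apply; rewrite /= size_rcons sps.
  rewrite -[in RHS](sqr_sqrtr hl); ring.
rewrite big_split /=; have -> : \prod_(i < m.+2) (if i == m.+1 :> nat then ph else 1) = ph.
  rewrite big_ord_recr /= eqxx big1 ?mul1r // => i _.
  by rewrite ltn_eqF.
rewrite -rmorph_prod big_split /= (prod_sqrt_weights sps b0 hge pb).
rewrite prodr_const card_ord.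
have e : toC (2 ^+ m.+2 * b) * ph = 2 ^+ m.+2 * (toC b * ph).
  by rewrite rmorphM rmorphXn rmorph_nat mulrA.
by apply: etrans e _; rewrite eph mulrCA mulrA.
Qed.
End Final.

(** * The representation theorem *)

Lemma exists_phase (C : numClosedFieldType) k (al : C) :
  exists ph : C, ph * ph^* = 1 /\ `|al| * ph = (-1) ^+ k * al^*.
Proof.
have [->|a0] := eqVneq al 0.
  by exists 1; rewrite conjC1 mul1r normr0 conjC0 mul0r mulr0.
have na : `|al| != 0 by rewrite normr_eq0.
exists ((-1) ^+ k * al^* / `|al|); split; last by rewrite mulrC divfK.
rewrite -normCK !normrM normfV normr_id norm_conjC normrX normrN1 expr1n mul1r.
by rewrite divff // expr1n.
Qed.

Section Last.
Variable R : realType.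
Local Notation C := R[i].
Local Notation toC := (real_complex R).
Local Notation u := (uvar R).
Local Notation v := (vvar R).

Lemma exists_sign k (r b : R) : 0 <= b -> toC b = `|toC r| ->
  exists s : R, s * s = 1 /\ b * s = (-1) ^+ k * r.
Proof.
move=> b0 eb; have eb2 : b ^+ 2 = r ^+ 2.
  apply: (@complexI R); rewrite !rmorphXn /= eb sqr_normc.
  by rewrite /= oppr0 -expr2.
have : (b == r) || (b == - r) by rewrite -eqf_sqr eb2.
case/orP => /eqP ->.
  by exists ((-1) ^+ k); rewrite -expr2 sqrr_sign mulrC.
by exists (- (-1) ^+ k); rewrite mulrNN -expr2 sqrr_sign mulrNN mulrC.
Qed.

Lemma normal_form_1 (P : {poly R}) al : size P = 2 -> P \is monic ->
  normal_form 1 (map_poly toC P) al al^* =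
  det_poly (cyclic_shift (fun _ : 'I_1 => 2 * al^*)).
Proof.
move=> sP mP; rewrite det_poly_cyclic det_mx11.
have addE (M N : 'M[{mpoly C[3]}]_1) i j : (M + N) i j = M i j + N i j by rewrite mxE.
have -> : cyclic_tridiag 'X_0 (upper (fun _ : 'I_1 => 2 * al^*))
    (lower (fun _ : 'I_1 => 2 * al^*)) 0 0 =
    'X_0 + (2 * al^*)%:MP * (2^-1 *: v) + ((2 * al^*)^*)%:MP * (2^-1 *: u).
  apply: etrans (addE _ _ _ _) _; apply: (congr2 +%R); last by rewrite mxE mxE.
  by apply: etrans (addE _ _ _ _) _; rewrite mxE mxE.
have half (x : C) (Y : {mpoly C[3]}) : (2 * x)%:MP * (2^-1 *: Y) = x *: Y.
  by rewrite mul_mpolyC scalerA mulrAC divff ?mul1r // pnatr_eq0.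
have c2 : (2 * al^*)^* = 2 * al.
  by apply: etrans (rmorphM _ _ _) _; rewrite /= conjCK; congr (_ * _); apply: rmorph_nat.
have P1 : P`_1 = 1 by move: mP; rewrite monicE lead_coefE sP => /eqP.
have h1 : homogenize (@mpolyC 3 C) 'X_0 (u * v) 1 (map_poly toC P) = 'X_0.
  by rewrite /homogenize big_ord1 coef_map /= P1 mul1r expr0 mulr1.
rewrite c2 2!half /normal_form h1.
by rewrite -(addrA 'X_0 (al *: _)) -(addrA 'X_0 (al^* *: _)) (addrC (al *: _)).
Qed.
End Last.

Theorem theorem1p6 (R : realType) (n : nat) (f : {mpoly R[3]})
  (n_gt0 : (0 < n)%N)
  (f_homog : f \is n.-homog)
  (f_hyp : hyperbolic f (vec3 1 0 0))
  (f_e : f.@[vec3 1 0 0] = 1) :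
  (cyclic_invariant n f ->
     exists a : 'I_n -> R[i],
       map_mpoly (real_complex R) f = det_poly (cyclic_shift a)) /\
  (dihedral_invariant n f ->
     exists b : 'I_n -> R,
       map_mpoly (real_complex R) f =
         det_poly (map_mx (real_complex R) (cyclic_shift b))).
Proof.
split=> [inv|[inv invG]].
  have [P [al [b dat]]] := cyclic_invariant_data n_gt0 f_homog f_hyp f_e inv.
  case: n n_gt0 f_homog inv dat => [//|[|m]] _ _ _ dat.
    by case: dat => -> sP mP _ _; eexists; apply: normal_form_1.
  have [ph [ph1 eph]] := exists_phase m.+1 al.
  have [_ _ _ _ [_ eb _]] := dat; rewrite -eb in eph.
  have [s ->] := weights_to_matrix dat ph1 eph.
  by eexists.
have [P [al [b dat]]] := cyclic_invariant_data n_gt0 f_homog f_hyp f_e inv.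
have [r er] := dihedral_alpha_real n_gt0 dat invG.
have real_shift k (s : 'I_k -> R) (a : 'I_k -> R[i]) : (forall i, a i = real_complex R (s i)) ->
    cyclic_shift a = map_mx (real_complex R) (cyclic_shift s).
  by move=> e; apply/matrixP => i j; rewrite !mxE e; case: eqP.
case: n n_gt0 f_homog inv dat => [//|[|m]] _ _ _ dat.
  case: dat => -> sP mP _ _; exists (fun _ => 2 * r).
  rewrite (normal_form_1 _ sP mP); apply: congr1; apply: real_shift => _.
  by rewrite er toC_conj rmorphM rmorph_nat.
have [_ _ _ _ [b0 eb _]] := dat; rewrite er in eb.
have [s [s1 es]] := exists_sign m.+1 b0 eb.
have [||c ->] := weights_to_matrix (ph := real_complex R s) dat.
- by rewrite toC_conj -rmorphM s1 rmorph1.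
- by rewrite er toC_conj -rmorphM es rmorphM rmorph_sign.
exists (fun i => c i * (if i == m.+1 :> nat then s else 1)).
apply: congr1; apply: real_shift => i.
by rewrite rmorphM; case: ifP => // _; rewrite rmorph1.
Qed.
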